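(* Let $n\geq 2$ and let $X\subset \mathbb{P}^n$ be a reduced hypersurface of degree $d$ over $\mathbb{F}_q$. Suppose that (i) $q\geq \frac{3}{2}d(d-1)$ if $n=2$; (ii) $q\geq d(d-1)+1$ if $n=3$; (iii) $q\geq d$ if $n\geq 4$. Then there exists a hyperplane $H\subset\mathbb{P}^n$ defined over $\mathbb{F}_q$ such that $X\cap H$ is reduced and has dimension $n-2$.
   Context: $X\cap H$ denotes the scheme-theoretic intersection. A scheme is reduced if its structure sheaf has no nonzero nilpotent sections on any open subset; since $\mathbb{F}_q$ is perfect, being reduced over $\mathbb{F}_q$ is equivalent to being reduced over $\overline{\mathbb{F}_q}$. A hypersurface $\{F=0\}\subset\mathbb{P}^n$ over $\mathbb{F}_q$ is reduced if and only if the irreducible factors of $F$ over $\overline{\mathbb{F}_q}$ are pairwise coprime. *)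

(* Defs.v *)
From mathcomp Require Import all_boot all_algebra ring_quotient.
From mathcomp Require Import mpoly.

Set Implicit Arguments.
Unset Strict Implicit.
Unset Printing Implicit Defensive.

Import GRing.Theory.
Local Open Scope ring_scope.

Section ProjectiveSubschemes.
Variables (k : fieldType) (n : nat).

(* A closed subscheme Proj (S / I) of P^n over k, with S = k[x_0, ..., x_n],   *)
(* is given by a homogeneous ideal I of S. Ideals differing only by an         *)
(* S_+-torsion part define the same subscheme: the notions below see I only    *)
(* through its localizations at forms of positive degree.                      *)
Definition subscheme := {mpoly k[n.+1]} -> Prop.

Definition hypersurface (F : {mpoly k[n.+1]}) : subscheme :=
  fun p => exists c, p = c * F.

(* The scheme-theoretic intersection is cut out by the sum of the ideals.      *)
Definition scheme_inter (X Y : subscheme) : subscheme :=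
  fun p => exists u v, [/\ X u, Y v & p = u + v].

Definition is_hyperplane (H : subscheme) : Prop :=
  exists L : {mpoly k[n.+1]}, [/\ L != 0, L \is 1.-homog & H = hypersurface L].

(* For a form f of degree e > 0, the sections of the structure sheaf of X over *)
(* the basic open set D_+(f) are the fractions a / f^j with a a form of degree *)
(* j * e, and a / f^j = 0 iff f^N * a lies in the ideal for some N. The        *)
(* D_+(f) form a basis of the topology, so it is enough to exclude nilpotent   *)
(* sections on them.                                                           *)
Definition zero_section (X : subscheme) (f a : {mpoly k[n.+1]}) : Prop :=
  exists N : nat, X (f ^+ N * a).

Definition reduced (X : subscheme) : Prop :=
  forall (e j m : nat) (f a : {mpoly k[n.+1]}),
    (0 < e)%N -> f \is e.-homog -> a \is (j * e).-homog ->
    zero_section X f (a ^+ m) -> zero_section X f a.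

(* Points of Proj S: homogeneous primes not containing the ideal S_+           *)
(* (properness is part of idealr_closed).                                      *)
Definition proj_point (P : {pred {mpoly k[n.+1]}}) : Prop :=
  [/\ idealr_closed P, prime_idealr_closed P,
      forall p e, p \in P -> pihomog mdeg e p \in P
    & exists i : 'I_n.+1, 'X_i \notin P].

Definition point_of (X : subscheme) (P : {pred {mpoly k[n.+1]}}) : Prop :=
  proj_point P /\ forall p, X p -> p \in P.

(* Strictly increasing chains C 0 < ... < C l of points of X; they correspond  *)
(* to strictly decreasing chains of irreducible closed subsets of X, each      *)
(* irreducible closed subset being the closure of a unique point.              *)
Definition point_chain (X : subscheme) (l : nat)
    (C : nat -> {pred {mpoly k[n.+1]}}) : Prop :=
  (forall i, (i <= l)%N -> point_of X (C i)) /\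
  (forall i, (i < l)%N ->
     {subset C i <= C i.+1} /\ exists2 p, p \in C i.+1 & p \notin C i).

(* Krull dimension of X; the empty scheme has no dimension in this sense.      *)
Definition has_dim (X : subscheme) (r : nat) : Prop :=
  (exists C, point_chain X r C) /\
  (forall l C, point_chain X l C -> (l <= r)%N).

End ProjectiveSubschemes.

(* Main.v *)
(* Let [S = k[x_0, ..., x_n]] and let [v] be a rational point with [F (v) <> 0], scaled to [F (v) = 1]. Then
   [F (x + t v)] is monic in [t] over [S], which replaces unique factorization in [S] by factorization
   over the fraction field of [S]. Reducedness of [X] makes [F (x + t v)] squarefree there, and since [k] is
   perfect each of its irreducible factors fails to divide some partial derivative. Each factor thus
   excludes a proper subspace of directions [u], and as there are at most [d <= q] factors, some
   derivative [D_u F] is coprime to [F].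
     Let [R] in [S] be the resultant in [t] of [F (x + t v)] and [D_u F (x + t v)]: it is nonzero of degree at
   most [d (d - 1)]. If [R (y) <> 0] and [H] is a rational hyperplane through [u], [v] and [y], then [F|_H] and its
   derivative [D_u (F|_H)] are coprime, so [F|_H] is squarefree. For [n = 3] one can take [y] rational because
   [d (d - 1) < q], and three points lie in a plane. For [n >= 4] one has [d (d - 1) < q ^ 2], which gives
   [y = a + s b] with [a], [b] rational and [s] transcendental, and four points lie in a hyperplane. For
   [n = 2] one needs [u = v]; this is possible because either [v] itself works or some factor is
   inseparable, and then the at most [d - 1] excluded subspaces together with [X] do not cover the
   rational points.
     The dimension of [X \cap H] is bounded above by counting, which shows that [n + 2] elements of [S] are
   algebraically dependent, and below by a chain of primes lying over the primes generated by
   variables of a polynomial ring over which [X \cap H] is finite. *)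

Require Import Defs.
From HB Require Import structures.
From Stdlib Require Import Classical FunctionalExtensionality PropExtensionality.
From mathcomp Require Import all_boot all_algebra ring_quotient.
From mathcomp Require Import finfield perm zify.
From mathcomp Require Import mpoly.

Set Implicit Arguments.
Unset Strict Implicit.
Unset Printing Implicit Defensive.

Import GRing.Theory.
Local Open Scope ring_scope.
Local Notation widen := (widen_ord (leqnSn _)).

(** * Resultants as norms *)

Section Norm.

(** Companion matrix, with [f] read as monic of degree [d.+1]: on row vectors it is multiplication
    by ['X] modulo [f] in the basis of powers of ['X]. *)
Definition cmx (R : nzRingType) d (f : {poly R}) : 'M[R]_d.+1 :=
  \matrix_(i, j) if i == d :> nat then - f`_j else (i.+1 == j :> nat)%:R.

(** Norm of [c] from [R[t] / (f)], which for monic [f] is the resultant of [f] and [c]. It is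
    compatible with ring morphisms even if the degree of [c] drops. *)
Definition pnorm (R : comNzRingType) d (f c : {poly R}) : R :=
  \det (horner_mx (cmx d f) c).

Lemma map_pnorm (R S : comNzRingType) (phi : {rmorphism R -> S}) d f c :
  phi (pnorm d f c) = pnorm d (map_poly phi f) (map_poly phi c).
Proof.
rewrite /pnorm -det_map_mx map_horner_mx; congr (\det (horner_mx _ _)).
apply/matrixP=> i j; rewrite !mxE coef_map; case: ifP => _.
  by rewrite rmorphN.
by rewrite rmorph_nat.
Qed.

Lemma row0_cmxX (R : comNzRingType) d (f : {poly R}) i (lt_id : (i < d.+1)%N) :
  delta_mx 0 0 *m cmx d f ^+ i = delta_mx 0 (Ordinal lt_id) :> 'rV_d.+1.
Proof.
elim: i lt_id => [|i IHi] lt_id.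
  by rewrite expr0 mulmx1; congr delta_mx; apply/val_inj.
rewrite exprSr mulmxA (IHi (ltnW lt_id)).
apply/rowP=> j; rewrite mxE (bigD1 (Ordinal (ltnW lt_id))) //= !mxE !eqxx mul1r.
rewrite big1 ?addr0 => [|l nl]; last by rewrite !mxE eqxx /= (negPf nl) mul0r.
by rewrite ltn_eqF //= eq_sym.
Qed.

Lemma row0_horner_cmx (R : comNzRingType) d (f c : {poly R}) :
  (size c <= d.+1)%N -> delta_mx 0 0 *m horner_mx (cmx d f) c = poly_rV c :> 'rV_d.+1.
Proof.
move=> sc; rewrite -{1}(coefK c) poly_def.
rewrite rmorph_sum /= mulmx_sumr; apply/rowP=> j; rewrite summxE !mxE.
under eq_bigr => i _.
  rewrite linearZ /= rmorphXn /= horner_mx_X -scalemxAr.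
  rewrite (row0_cmxX _ (leq_trans (ltn_ord i) sc)) !mxE eqxx /= -val_eqE /= eq_sym.
  over.
case: (ltnP j (size c)) => jc.
  rewrite (bigD1 (Ordinal jc)) //= eqxx mulr1 big1 ?addr0 // => i.
  by rewrite -val_eqE /= => /negPf->; rewrite mulr0.
rewrite nth_default // big1 // => i _.
by rewrite (ltn_eqF (leq_trans (ltn_ord i) jc)) mulr0.
Qed.

Lemma horner_cmx_eq0 (R : comNzRingType) d (f c : {poly R}) :
  (size c <= d.+1)%N -> horner_mx (cmx d f) c = 0 -> c = 0.
Proof.
move=> sc c0; have := row0_horner_cmx f sc; rewrite c0 mulmx0 => /esym v0.
by rewrite -(poly_rV_K sc) v0 linear0.
Qed.

(** The last row is chosen so that [f] of the companion matrix kills the first basis vector. That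
    vector is cyclic, and [f] of the matrix commutes with its powers, so every basis vector is
    killed. *)
Lemma horner_cmxK (R : comNzRingType) d (f : {poly R}) :
  f \is monic -> size f = d.+2 -> horner_mx (cmx d f) f = 0.
Proof.
move=> monf sf; set C := cmx d f.
have row0 : delta_mx 0 0 *m horner_mx C f = 0 :> 'rV_d.+1.
  have -> : f = 'X^(d.+1) + \poly_(i < d.+1) f`_i.
    apply/polyP=> i; rewrite coefD coefXn coef_poly.
    case: ltngtP => [lt_i|lt_i|->]; rewrite ?add0r ?addr0 //.
      by rewrite nth_default // sf.
    by rewrite -(eqP monf) lead_coefE sf.
  rewrite rmorphD rmorphXn /= horner_mx_X mulmxDr exprSr mulmxA.
  rewrite (row0_cmxX _ (ltnSn d)) row0_horner_cmx ?size_poly //.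
  apply/rowP=> j; rewrite !mxE (bigD1 (Ordinal (ltnSn d))) //= !mxE !eqxx mul1r.
  rewrite big1 => [|l nl]; last by rewrite !mxE eqxx /= (negPf nl) mul0r.
  rewrite addr0 coef_poly ltn_ord [in X in - X](_ : f`_j = f`_j) //.
  by rewrite addNr.
apply/row_matrixP=> i; rewrite linear0 rowE.
have -> : i = Ordinal (ltn_ord i) by apply/val_inj.
rewrite -(row0_cmxX f (ltn_ord i)) -mulmxA.
have -> : C ^+ i *m horner_mx C f = horner_mx C f *m C ^+ i.
  by have := comm_horner_mx2 C 'X^i f; rewrite rmorphXn /= horner_mx_X.
by rewrite mulmxA row0 mul0mx.
Qed.

(** A Bezout relation makes [c] of the companion matrix invertible up to a nonzero scalar.
    Conversely, let [g] be a common factor with [a *: f = e * g]: the matrix of [g] has nonzero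
    determinant, so [e] acts as zero, and this forces [e = 0] if [g] has positive degree. *)
Lemma pnorm_coprimep (R : idomainType) d (f c : {poly R}) :
  f \is monic -> size f = d.+2 -> (pnorm d f c != 0) = coprimep f c.
Proof.
move=> monf sf; apply/idP/idP=> [nm|]; last first.
  case/Pdiv.Idomain.Bezout_coprimepP=> -[u v] /=.
  rewrite -size_poly_eq1 => /size_poly1P[a a0 /(congr1 (horner_mx (cmx d f)))].
  rewrite rmorphD !rmorphM /= horner_cmxK // mulr0 add0r horner_mx_C.
  move/(congr1 determinant); rewrite det_mulmx det_scalar.
  apply: contra_eq_neq => n0; rewrite -/(pnorm d f c) n0 mulr0 eq_sym.
  by rewrite expf_neq0.
apply/Pdiv.Idomain.coprimepP=> g /Pdiv.Idomain.dvdpP[[a e] /= a0 ef] /Pdiv.Idomain.dvdpP[[b e'] /= b0 ec].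
have f0 : f != 0 by rewrite monic_neq0.
have eg0 : e * g != 0 by rewrite -ef -mul_polyC mulf_neq0 ?polyC_eq0.
have /andP[e0 g0] : (e != 0) && (g != 0) by rewrite -negb_or -mulf_eq0.
have detg : \det (horner_mx (cmx d f) g) != 0.
  have := congr1 (fun p => \det (horner_mx (cmx d f) p)) ec.
  rewrite rmorphM -mul_polyC rmorphM /= horner_mx_C !det_mulmx det_scalar.
  apply: contra_eq_neq => ->; rewrite mulr0 mulf_neq0 // expf_neq0 //.
have /horner_cmx_eq0 e_small : horner_mx (cmx d f) e = 0.
  have := congr1 (horner_mx (cmx d f)) ef.
  rewrite rmorphM -mul_polyC rmorphM /= horner_cmxK // mulr0 => /esym.
  move/(congr1 (fun M => M *m \adj (horner_mx (cmx d f) g))).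
  rewrite mul0mx -mulmxA mul_mx_adj mul_mx_scalar.
  move=> /matrixP deg0; apply/matrixP=> i j; move: (deg0 i j); rewrite !mxE.
  by move/eqP; rewrite mulf_eq0 (negPf detg) => /eqP.
have se : (size e + size g).-1 = d.+2.
  by rewrite -size_mul // -ef size_scale.
rewrite -size_poly_eq1 eqn_leq size_poly_gt0 g0 andbT leqNgt.
apply: contra_neqN e0 => sg; apply: e_small.
by case: (size g) sg se => [//|[//|s]] _; rewrite !addnS /= => -[<-]; rewrite leq_addr.
Qed.

(* Coprimality with a monic polynomial spreads from a specialization. *)
Lemma coprimep_specialize (R S : idomainType) (phi : {rmorphism R -> S})
    (f c : {poly R}) :
  f \is monic -> (1 < size f)%N ->
  coprimep (map_poly phi f) (map_poly phi c) -> coprimep f c.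
Proof.
move=> monf; case sf : (size f) => [//|[//|d]] _ cop.
rewrite -(pnorm_coprimep _ monf sf); apply: contraTneq cop => n0.
rewrite -(@pnorm_coprimep _ d) ?monic_map //; last first.
  by rewrite size_map_poly_id0 // (eqP monf) rmorph1 oner_neq0.
by rewrite -map_pnorm n0 rmorph0 eqxx.
Qed.

End Norm.

(** * Factors and squarefreeness over the fraction field *)

Section PseudoFactors.
Variable R : idomainType.
Implicit Types f g h p q : {poly R}.

(** Over a domain, [%|] and [%=] ignore nonzero scalars of [R]; hence this is squarefreeness over
    the fraction field of [R], expressed without leaving [R]. *)
Definition sqfree f := forall g, g * g %| f -> g %= 1.

Lemma exists_irreducible_factor p :
  (1 < size p)%N -> exists2 g, irreducible_poly g & g %| p.
Proof.
have [n] := ubnP (size p); elim: n p => // n IHn p sp p1.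
case: (classic (irreducible_poly p)) => [irr|nirr]; first by exists p.
have [q [q1 qp nqp]] : exists q, [/\ size q != 1, q %| p & ~~ (q %= p)].
  apply: NNPP => nex; apply: nirr; split=> // q q1 qp.
  by case: (boolP (q %= p)) => // nqp; case: nex; exists q.
have p0 : p != 0 by rewrite -size_poly_gt0 (ltn_trans _ p1).
have q0 : q != 0 by apply: contraNneq p0 => q0; rewrite -dvd0p -q0.
have sq : (size q < size p)%N.
  by rewrite ltn_neqAle dvdp_leq // andbT dvdp_size_eqp.
have [||g irr gq] := IHn q; first exact: leq_trans sq _.
  by move: q1 q0; rewrite -size_poly_gt0; case: (size q) => [|[]].
by exists g => //; apply: dvdp_trans gq qp.
Qed.

Lemma irreducible_factorization p : p != 0 ->
  exists2 s : seq {poly R}, (forall g, g \in s -> irreducible_poly g)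
    & p %= \prod_(g <- s) g.
Proof.
have [n] := ubnP (size p); elim: n p => // n IHn p sp p0.
case: (ltnP 1 (size p)) => sp1; last first.
  exists [::] => [//|]; rewrite big_nil -size_poly_eq1.
  by rewrite eqn_leq sp1 size_poly_gt0.
have [g irr gp] := exists_irreducible_factor sp1.
case/Pdiv.Idomain.dvdpP: (gp) => -[a q] /= a0 e.
have g1 : (1 < size g)%N by case: irr.
have qg0 : q * g != 0 by rewrite -e -mul_polyC mulf_neq0 ?polyC_eq0.
have /andP[q0 g0] : (q != 0) && (g != 0) by rewrite -negb_or -mulf_eq0.
have se : size p = (size q + size g).-1 by rewrite -size_mul // -e size_scale.
have [||s irrs eqs] := IHn q => //.
  apply: leq_trans _ (sp : (size p <= n)%N); rewrite se.
  by case: (size g) g1 => [//|[//|m]] _; rewrite !addnS /= ltnS leq_addr.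
exists (g :: s); first by move=> h; rewrite inE => /predU1P[->|/irrs].
rewrite big_cons; apply: eqp_trans (_ : q * g %= _).
  by rewrite -e eqp_sym eqp_scale.
by rewrite mulrC eqp_mull.
Qed.

Lemma irreducible_neq0 g : irreducible_poly g -> g != 0.
Proof. by case=> g1 _; rewrite -size_poly_gt0 (ltn_trans _ g1). Qed.

Lemma irreducible_dvdpM g p q :
  irreducible_poly g -> (g %| p * q) = (g %| p) || (g %| q).
Proof.
move=> irr; apply/idP/orP=> [gpq|[gp|gq]]; last 2 first.
- exact: dvdp_mulr.
- exact: dvdp_mull.
case: (boolP (g %| p)) => [gp|np]; first by left.
right; move: gpq; rewrite Pdiv.Idomain.Gauss_dvdpr //.
by rewrite irreducible_poly_coprime.
Qed.

Lemma irreducible_dvdpX g p n :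
  irreducible_poly g -> g %| p ^+ n -> g %| p.
Proof.
move=> irr; elim: n => [|n IHn]; last by rewrite exprS irreducible_dvdpM // => /orP[].
rewrite expr0 dvdp1 => /eqP g1; case: irr; by rewrite g1.
Qed.

Lemma sum_size_factors (s : seq {poly R}) : (forall g, g \in s -> g != 0) ->
  (size (\prod_(g <- s) g)).-1 = (\sum_(g <- s) (size g).-1)%N.
Proof.
elim: s => [|g s IHs] s0; first by rewrite !big_nil size_poly1.
have g0 : g != 0 by apply: s0; rewrite inE eqxx.
have s0' h : h \in s -> h != 0 by move=> hs; apply: s0; rewrite inE hs orbT.
have p0 : \prod_(h <- s) h != 0.
  by rewrite prodf_seq_neq0; apply/allP=> h /s0'.
rewrite !big_cons size_mul // -(IHs s0').
by rewrite -[size g]prednK ?size_poly_gt0 // -[X in (_ + X)%N]prednK ?size_poly_gt0 // addSn addnS.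
Qed.

Lemma size_factors (s : seq {poly R}) p : p %= \prod_(g <- s) g ->
  (forall g, g \in s -> irreducible_poly g) -> (size s <= (size p).-1)%N.
Proof.
move=> /eqp_size-> irr; rewrite sum_size_factors => [|g /irr /irreducible_neq0 //].
rewrite -sum1_size big_seq [leqRHS]big_seq; apply: leq_sum => g /irr[g1 _].
by case: (size g) g1 => [|[]].
Qed.

Lemma size_factors_lt (s : seq {poly R}) p g : p %= \prod_(h <- s) h ->
  (forall h, h \in s -> irreducible_poly h) -> g \in s -> (2 < size g)%N ->
  (size s < (size p).-1)%N.
Proof.
move=> /eqp_size-> irr gs g2.
rewrite sum_size_factors => [|h /irr /irreducible_neq0 //].
rewrite (perm_size (perm_to_rem gs)) (perm_big _ (perm_to_rem gs)) /= big_cons.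
have: (size (rem g s) <= \sum_(h <- rem g s) (size h).-1)%N.
  rewrite -sum1_size big_seq [leqRHS]big_seq; apply: leq_sum => h /mem_rem /irr[h1 _].
  by case: (size h) h1 => [|[]].
case: (size g) g2 => [//|[//|[//|m]]] _ le.
exact: (@leq_add 2 _ m.+2 _ isT le).
Qed.

Lemma coprimep_factors (s : seq {poly R}) p c : p %= \prod_(g <- s) g ->
  (forall g, g \in s -> irreducible_poly g) ->
  (forall g, g \in s -> ~~ (g %| c)) -> coprimep p c.
Proof.
move=> eqp irr ndiv; rewrite (eqp_coprimepl _ eqp).
elim: s irr ndiv {eqp} => [|g s IHs] irr ndiv; first by rewrite big_nil coprime1p.
rewrite big_cons coprimepMl irreducible_poly_coprime; last first.
  by apply: irr; rewrite inE eqxx.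
rewrite ndiv ?inE ?eqxx //=; apply: IHs => h hs; first by apply: irr; rewrite inE hs orbT.
by apply: ndiv; rewrite inE hs orbT.
Qed.

(** Squarefreeness makes each irreducible factor coprime to the product of the others, so by Gauss
    divisibility can be tested one factor at a time. *)
Lemma sqfree_dvdpX f g n : f != 0 -> sqfree f -> f %| g ^+ n -> f %| g.
Proof.
move=> f0; have [s irr eqf] := irreducible_factorization f0.
have sqE h : (h %| f) = (h %| \prod_(g <- s) g) by rewrite (eqp_dvdr _ eqf).
move=> sqf; rewrite !(eqp_dvdl _ eqf).
have {sqf sqE} : sqfree (\prod_(g <- s) g) by move=> h; rewrite -sqE; apply: sqf.
elim: s irr {eqf} => [|h s IHs] irr; first by move=> _ _; rewrite big_nil dvd1p.
have irrh : irreducible_poly h by apply: irr; rewrite inE eqxx.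
have irrs l : l \in s -> irreducible_poly l by move=> ls; apply: irr; rewrite inE ls orbT.
rewrite big_cons => sqf.
have cop : coprimep h (\prod_(l <- s) l).
  rewrite irreducible_poly_coprime //; apply/negP=> hs.
  have /sqf : h * h %| h * \prod_(l <- s) l by apply: dvdp_mul.
  by rewrite -size_poly_eq1 => /eqP h1; case: irrh; rewrite h1.
rewrite !Pdiv.Idomain.Gauss_dvdp // => /andP[/irreducible_dvdpX->] //=.
by apply: IHs => // l lP; apply: sqf; apply: dvdp_mull.
Qed.

(** [E] will be d/dt as well as derivations acting on the coefficients; the latter do not kill the
    scalars of [R] that pseudo-division introduces. *)
Variable E : {poly R} -> {poly R}.
Hypothesis E_leibniz : forall p q, E (p * q) = E p * q + p * E q.

(** If [a *: f = q * (g * g)], then [g] divides [E a * f + a * E f], hence also [E f]. *)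
Lemma coprimep_deriv_sqfree f : coprimep f (E f) -> sqfree f.
Proof.
move=> cop g ggf; case/Pdiv.Idomain.dvdpP: (ggf) => -[a q] /= a0 e.
have gf : g %| f by apply: dvdp_trans ggf; apply: dvdp_mulIl.
apply: (Pdiv.Idomain.coprimepP _ _ cop) => //.
have := congr1 E e; rewrite -mul_polyC !E_leibniz => eE.
have : g %| E a%:P * f + a%:P * E f.
  rewrite eE; apply: dvdp_add; first by apply: dvdp_mull; apply: dvdp_mulIl.
  apply: dvdp_mull; rewrite dvdp_add ?dvdp_mulIl //; exact: dvdp_mulIr.
by rewrite (dvdp_addr _ (dvdp_mull _ gf)) mul_polyC dvdpZr.
Qed.

(** From [a *: f = q * g] one gets [g %| q * E g], and [g %| q] would make [g * g] divide [f]. *)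
Lemma sqfree_dvdp_deriv f g : sqfree f -> irreducible_poly g ->
  g %| f -> g %| E f -> g %| E g.
Proof.
move=> sqf irr gf gE; case/Pdiv.Idomain.dvdpP: (gf) => -[a q] /= a0 e.
have: g %| q * E g.
  have := congr1 E e; rewrite -mul_polyC !E_leibniz => eE.
  rewrite -(dvdp_addr _ (dvdp_mull (E q) (dvdpp g))) -eE.
  by rewrite dvdp_add ?dvdp_mull.
rewrite irreducible_dvdpM // => /orP[gq|//].
have /sqf : g * g %| f by rewrite -(dvdpZr _ _ a0) e; apply: dvdp_mul.
by rewrite -size_poly_eq1 => /eqP g1; case: irr; rewrite g1.
Qed.

End PseudoFactors.

(** * Morphisms of polynomial rings and nonvanishing on grids *)

Section MpolyMorphisms.

Lemma mpoly_morph_eq (n : nat) (R : nzRingType) (S : comNzRingType)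
    (f g : {rmorphism {mpoly R[n]} -> S}) :
  (forall c, f c%:MP = g c%:MP) -> (forall i, f 'X_i = g 'X_i) -> f =1 g.
Proof.
move=> eqC eqX p; rewrite (mpolyE p) !rmorph_sum; apply: eq_bigr => m _.
rewrite -mul_mpolyC !rmorphM eqC; congr (_ * _).
rewrite mpolyXE_id !rmorph_prod; apply: eq_bigr => i _.
by rewrite !rmorphXn eqX.
Qed.

(* Two morphisms that agree modulo an ideal on the generators agree modulo it everywhere. *)
Lemma mpoly_morph_mod (n : nat) (R : nzRingType) (S : comNzRingType)
    (f g : {rmorphism {mpoly R[n]} -> S}) (I : S -> Prop) :
  I 0 -> (forall a b, I a -> I b -> I (a + b)) -> (forall a b, I b -> I (a * b)) ->
  (forall c, I (f c%:MP - g c%:MP)) -> (forall i, I (f 'X_i - g 'X_i)) ->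
  forall p, I (f p - g p).
Proof.
move=> I0 ID IM IC IX.
have IMM a b a' b' : I (a - a') -> I (b - b') -> I (a * b - a' * b').
  move=> Ia Ib; have -> : a * b - a' * b' = b * (a - a') + a' * (b - b').
    by rewrite !mulrBr addrA [b * a]mulrC [b * a']mulrC subrK.
  by apply: ID; apply: IM.
have I1 : I (1 - 1) by rewrite subrr.
have IMX a b e : I (a - b) -> I (a ^+ e - b ^+ e).
  move=> Iab; elim: e => [|e IHe]; first by rewrite !expr0.
  by rewrite !exprS; apply: (IMM _ _ _ _ Iab IHe).
have IMp (J : finType) (F G : J -> S) :
    (forall j, I (F j - G j)) -> I (\prod_j F j - \prod_j G j).
  move=> FG; apply: (big_ind2 (fun a b => I (a - b))) => // a a' b b' Ia Ib.
  exact: IMM.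
move=> p; rewrite (mpolyE p) !rmorph_sum /=.
apply: (big_ind2 (fun a b => I (a - b))); first by rewrite subrr.
  by move=> a a' b b' Ia Ib; rewrite opprD addrACA; apply: ID.
move=> m _; rewrite -mul_mpolyC !rmorphM; apply: IMM => //.
rewrite mpolyXE_id !rmorph_prod; apply: IMp => i; rewrite !rmorphXn.
exact: IMX.
Qed.

Lemma homog_mdeg n (R : nzRingType) (p : {mpoly R[n]}) e m :
  p \is e.-homog -> m \in msupp p -> mdeg m = e.
Proof. by move=> hp; apply: (dhomog_mf hp). Qed.

Definition mext n (m : 'X_{1..n}) (j : nat) : 'X_{1..n.+1} := [multinom of rcons m j].

Lemma mext_widen n (m : 'X_{1..n}) j i : mext m j (widen i) = m i.
Proof. by rewrite !(mnm_nth 0%N) nth_rcons size_tuple /=; case: i => i /= ->. Qed.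

Lemma mext_max n (m : 'X_{1..n}) j : mext m j ord_max = j.
Proof. by rewrite multinomE (tnth_nth 0%N) nth_rcons /= size_tuple ltnn eqxx. Qed.

Lemma widen_lift n (i : 'I_n) : widen i = lift ord_max i.
Proof. by apply/val_inj; rewrite /= /bump leqNgt ltn_ord. Qed.

Lemma mextE n (m : 'X_{1..n.+1}) :
  m = mext [multinom m (widen i) | i < n] (m ord_max).
Proof.
apply/mnmP=> i; case: (unliftP ord_max i) => [j ->|->]; last by rewrite mext_max.
by rewrite -widen_lift mext_widen mnmE.
Qed.

Lemma coef_muni (n : nat) (R : nzRingType) (p : {mpoly R[n.+1]}) j m :
  (muni p)`_j@_m = p@_(mext m j).
Proof.
rewrite muniE coef_sum raddf_sum /=.
under eq_bigr => m' _.
  rewrite -[p@__ *: _ *: _]mul_polyC coefCM coefXn -scalerAl mcoeffZ mulr_natr.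
  rewrite mcoeffMn mcoeffX.
  have -> : (([multinom m' (widen i) | i < n] == m)%:R *+ (j == m' ord_max) : R) =
    (m' == mext m j)%:R.
    have -> : (m' == mext m j) =
       ([multinom m' (widen i) | i < n] == m) && (j == m' ord_max).
      apply/eqP/andP => [->|[/eqP e1 /eqP e2]].
        by rewrite mext_max; split=> //; apply/eqP/mnmP=> i; rewrite mnmE mext_widen.
      by rewrite [m']mextE e1 -e2.
    by case: eqP; case: eqP.
  over.
case: (boolP (mext m j \in msupp p)) => [mp|mp].
  rewrite (bigD1_seq _ mp) ?msupp_uniq //= eqxx mulr1 big1 ?addr0 // => m' /negPf->.
  by rewrite mulr0.
rewrite (memN_msupp_eq0 mp) big_seq big1 // => m' m'p.
by rewrite (_ : _ == _ = false) ?mulr0 //; apply: contraNF mp => /eqP<-.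
Qed.

Lemma meval_muni (n : nat) (R : comNzRingType) (p : {mpoly R[n.+1]})
    (v : 'I_n.+1 -> R) :
  p.@[v] = (map_poly (meval (fun i => v (widen i))) (muni p)).[v ord_max].
Proof.
rewrite muniE rmorph_sum /= horner_sum mevalE; apply: eq_bigr => m _.
rewrite -mul_polyC rmorphM /= map_polyC /= map_polyXn hornerM hornerC hornerXn.
rewrite mevalZ mevalX -mulrA; congr (_ * _); rewrite big_ord_recr /=; congr (_ * _).
by apply: eq_bigr => i _; rewrite mnmE.
Qed.

(** Induction on the number of variables: at a point where some coefficient in the last variable
    survives, the remaining one-variable polynomial has fewer roots than [s] has elements. *)
Lemma mpoly_grid_neq0 (R : idomainType) (n : nat) (s : seq R) (p : {mpoly R[n]}) :
  uniq s -> p != 0 -> (forall m, m \in msupp p -> forall i, (m i < size s)%N) ->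
  exists2 v : 'I_n -> R, (forall i, v i \in s) & p.@[v] != 0.
Proof.
move=> us; elim: n p => [|n IHn] p p0 ps.
  exists (fun=> 0); first by case.
  by move: p0; rewrite (nvar0_mpolyC p) mevalC mpolyC_eq0.
have [m mp] : exists m, m \in msupp p.
  by move: p0; rewrite -msupp_eq0; case: (msupp p) => // m ? _; exists m; rewrite inE eqxx.
pose q := (muni p)`_(m ord_max).
have q0 : q != 0.
  apply/eqP=> /(congr1 (mcoeff [multinom m (widen i) | i < n])).
  by rewrite coef_muni -mextE mcoeff0 => /eqP; rewrite mcoeff_eq0 mp.
have [||v vs qv] := IHn q => //.
  move=> m' m'q i; rewrite -(mext_widen m' (m ord_max)); apply: ps.
  by rewrite mcoeff_msupp -coef_muni -mcoeff_msupp.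
pose u := map_poly (meval v) (muni p).
have u0 : u != 0.
  by apply: contraNneq qv => u0; rewrite -coef_map /= -/u u0 coef0.
have su : (size u <= size s)%N.
  apply/leq_sizeP=> j sj; rewrite coef_map /= (_ : (muni p)`_j = 0) ?meval0 //.
  apply/mpolyP=> m'; rewrite coef_muni mcoeff0; apply: memN_msupp_eq0.
  by apply/negP=> /ps/(_ ord_max); rewrite mext_max ltnNge sj.
have [a as_ ua] : exists2 a, a \in s & u.[a] != 0.
  have /allPn[a as_ ra] : ~~ all (root u) s.
    apply: contraTN su => rs; rewrite -ltnNge; exact: max_poly_roots u0 rs us.
  by exists a.
exists (fun i => if unlift ord_max i is Some j then v j else a).
  by move=> i; case: unliftP.
rewrite meval_muni unlift_none; apply: contraNneq ua => <-; apply/eqP.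
congr (_.[a]); rewrite /u; apply/polyP=> j; rewrite !coef_map /=.
apply: meval_eq => i.
by rewrite widen_lift liftK.
Qed.

(* For a form the bound may be reached: a monomial [x_i ^ e] is detected at the i-th unit vector. *)
Lemma dhomog_grid_neq0 (R : idomainType) (n : nat) (s : seq R) (p : {mpoly R[n]}) e :
  uniq s -> 0 \in s -> 1 \in s -> p != 0 -> p \is e.-homog -> (e <= size s)%N ->
  exists2 v : 'I_n -> R, (forall i, v i \in s) & p.@[v] != 0.
Proof.
move=> us s0 s1 p0 hp es.
have le_e m i : m \in msupp p -> (m i <= e)%N.
  by move=> /(homog_mdeg hp) <-; rewrite mdegE (bigD1 i) //= leq_addr.
case: (boolP (has (fun m : 'X_{1..n} => [exists i, m i == e]) (msupp p))) => [/hasP[m mp]|].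
  case/existsP=> i /eqP mi; exists (fun j => (i == j)%:R).
    by move=> j; case: (i == j).
  have mE : m = (U_(i) *+ e)%MM.
    apply/mnmP=> j; rewrite mulmnE mnm1E.
    have := homog_mdeg hp mp; rewrite mdegE (bigD1 i) //= mi => /eqP.
    rewrite -[X in _ == X]addn0 eqn_add2l sum_nat_eq0 => /forallP/(_ j).
    rewrite implybE negbK eq_sym; case: eqP => [<- _|_ /= /eqP->//].
    by rewrite mul1n mi.
  rewrite mevalE (bigD1_seq m) ?msupp_uniq //= [X in _ + X]big1_seq ?addr0.
    rewrite mE big1 ?mulr1 -?mE -?mcoeff_msupp // => j _.
    by rewrite mE mulmnE mnm1E; case: eqP; rewrite ?expr1n // mul0n expr0.
  move=> m' /andP[nm m'p]; rewrite (_ : \prod_j _ = 0) ?mulr0 //.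
  have [j /andP[nj m'j]] : exists j, (i != j) && (m' j != 0%N).
    apply/existsP; apply: contraNT nm => /existsPn m'0; apply/eqP.
    have m'0' j : j != i -> m' j = 0%N.
      by move=> ji; apply/eqP; have := m'0 j; rewrite eq_sym ji /= negbK.
    rewrite mE; apply/mnmP=> j; rewrite mulmnE mnm1E.
    case: eqP => [<-|/eqP ij]; last by rewrite m'0' // eq_sym.
    have := homog_mdeg hp m'p; rewrite mdegE (bigD1 i) //= big1 ?addn0 ?mul1n //.
  by rewrite (bigD1 j) //= (negPf nj) expr0n (negPf m'j) mul0r.
move/hasPn=> lt_e; apply: mpoly_grid_neq0 => // m mp i.
have := lt_e m mp; rewrite negb_exists => /forallP/(_ i) mi.
by apply: leq_trans es; rewrite ltn_neqAle mi le_e.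
Qed.

End MpolyMorphisms.

(** * Degree bounds and algebraic dependence by counting *)

Section DegreeBounds.
Variables (n : nat) (R : nzRingType).
Implicit Types p q : {mpoly R[n]}.

Definition mdeg_le e p := forall m, m \in msupp p -> (mdeg m <= e)%N.

Lemma mdeg_leM e e' p q : mdeg_le e p -> mdeg_le e' q -> mdeg_le (e + e') (p * q).
Proof.
move=> hp hq m /msuppM_le/allpairsP[[m1 m2] /= [m1p m2q ->]].
by rewrite mdegD leq_add ?hp ?hq.
Qed.

Lemma mdeg_leX e p i : mdeg_le e p -> mdeg_le (e * i) (p ^+ i).
Proof.
move=> hp; elim: i => [|i IHi]; last by rewrite exprS mulnS; apply: mdeg_leM.
by rewrite expr0 muln0 => m; rewrite msupp1 inE => /eqP->; rewrite mdeg0.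
Qed.

Lemma mdeg_le_prod (I : Type) (s : seq I) (e : I -> nat) (F : I -> {mpoly R[n]}) :
  (forall i, mdeg_le (e i) (F i)) ->
  mdeg_le (\sum_(i <- s) e i) (\prod_(i <- s) F i).
Proof.
move=> hF; elim: s => [|i s IHs]; last by rewrite !big_cons; apply: mdeg_leM.
by rewrite !big_nil => m; rewrite msupp1 inE => /eqP->; rewrite mdeg0.
Qed.

End DegreeBounds.

Section AlgebraicDependence.
Variables (k : finFieldType) (n : nat).

(** Families are indexed by [nat], so that one can be lengthened without changing its type. *)
Definition mpoly_at r (b : nat -> {mpoly k[n]}) : {mpoly k[r]} -> {mpoly k[n]} :=
  mmap (@mpolyC n k) (fun i : 'I_r => b i).

Lemma mdeg_le_bound r (b : nat -> {mpoly k[n]}) :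
  exists D, forall i : 'I_r, mdeg_le D (b i).
Proof.
exists (\max_(i < r) msize (b i)) => i m /msize_mdeg_lt/ltnW.
by move/leq_trans; apply; apply: (leq_bigmax i).
Qed.

(** There are more polynomials in [r] variables with all exponents below [N] than there are possible
    values at [b], whose degrees are at most [M]. Two of them thus have the same value, and their
    difference is a relation. *)
Lemma algebraic_dependence r (b : nat -> {mpoly k[n]}) : (n < r)%N ->
  exists2 p : {mpoly k[r]}, p != 0 & mpoly_at b p = 0.
Proof.
move=> lt_nr; have [D hD] := mdeg_le_bound r b.
(* The choice of [E] gives [M + 1 <= E * N], and [E ^ n < N] gives
   [(E * N) ^ n < N ^ (n + 1) <= N ^ r]. *)
pose E := (r * D).+1; pose N := (E ^ n).+1.
pose M := (\sum_(i < r) D * N)%N.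
pose A := {ffun 'I_r -> 'I_N}; pose B := {ffun 'I_n -> 'I_M.+1}.
pose mA (a : A) : 'X_{1..r} := [multinom (a i : nat) | i < r].
pose mB (a : B) : 'X_{1..n} := [multinom (a i : nat) | i < n].
have mA_inj : injective mA.
  move=> a a' /mnmP e; apply/ffunP=> i; apply/val_inj.
  by have := e i; rewrite !mnmE.
pose P (c : {ffun A -> k}) : {mpoly k[r]} := \sum_a c a *: 'X_[mA a].
pose f c : {ffun B -> k} := [ffun t => (mpoly_at b (P c))@_(mB t)].
have PE c a : (P c)@_(mA a) = c a.
  rewrite raddf_sum (bigD1 a) //= mcoeffZ mcoeffX eqxx mulr1 big1 ?addr0 // => a' na.
  by rewrite mcoeffZ mcoeffX (inj_eq mA_inj) (negPf na) mulr0.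
have degP c : mdeg_le M (mpoly_at b (P c)).
  rewrite /mpoly_at rmorph_sum /= => m /msupp_sum_le/flattenP[s /mapP[a _ ->]].
  rewrite mmapZ mmapX /mmap1 mul_mpolyC => /msuppZ_le.
  move/(mdeg_le_prod (e := fun i => (D * mA a i)%N) (fun i => mdeg_leX (i := mA a i) (hD i))).
  move/leq_trans; apply; apply: leq_sum => i _.
  by rewrite leq_mul2l mnmE (ltnW (ltn_ord _)) orbT.
case: (boolP (injectiveb f)) => [/injectiveP/leq_card|/injectivePn[c [c' ncc' fcc']]].
  rewrite !card_ffun !card_ord leq_exp2l; last first.
    by rewrite (cardD1 0) (cardD1 1) !inE oner_neq0.
  rewrite leqNgt /M sum_nat_const card_ord => /negP[].
  have le_EN : ((r * (D * N)).+1 <= E * N)%N.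
    by rewrite /E mulnA mulSn addnC -addn1 leq_add2l.
  apply: (@leq_ltn_trans ((E * N) ^ n)); first by case: (n) => // n'; rewrite leq_exp2r.
  apply: (@leq_trans (N ^ n.+1)); last by rewrite leq_pexp2l.
  by rewrite expnMn expnS ltn_pmul2r ?expn_gt0.
exists (P c - P c').
  apply: contraNneq ncc' => /eqP; rewrite subr_eq0 => /eqP eP.
  by apply/eqP/ffunP=> a; rewrite -!PE eP.
apply/mpolyP=> m; rewrite mcoeff0 /mpoly_at rmorphB /= mcoeffB.
case: (leqP (mdeg m) M) => mM; last first.
  have out c0 : (mpoly_at b (P c0))@_m = 0.
    by apply/memN_msupp_eq0/negP=> /degP; rewrite leqNgt mM.
  by rewrite !out subrr.
have mi i : (m i < M.+1)%N.
  by rewrite ltnS (leq_trans _ mM) // mdegE (bigD1 i) //= leq_addr.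
have -> : m = mB [ffun i => Ordinal (mi i)] by apply/mnmP=> i; rewrite mnmE ffunE.
by have /ffunP/(_ [ffun i => Ordinal (mi i)]) := fcc'; rewrite !ffunE => ->; rewrite subrr.
Qed.

End AlgebraicDependence.

(** * Ideals and lengths of chains of primes *)

Section IdealClosed.
Variables (R : comNzRingType) (C : {pred R}).
Hypothesis idC : idealr_closed C.

Lemma idealr0 : 0 \in C. Proof. by case: idC. Qed.

Lemma idealrMl a u : u \in C -> a * u \in C.
Proof. by case: idC => C0 _ CM uC; rewrite -[a * u]addr0; apply: CM. Qed.

Lemma idealrD u v : u \in C -> v \in C -> u + v \in C.
Proof. by case: idC => _ _ CM uC vC; rewrite -[u]mul1r; apply: CM. Qed.

Lemma idealrB u v : u \in C -> v \in C -> u - v \in C.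
Proof. by move=> uC vC; rewrite -mulN1r; apply/idealrD/idealrMl. Qed.

Lemma idealr_sum (I : Type) (r : seq I) (P : pred I) (F : I -> R) :
  (forall i, P i -> F i \in C) -> \sum_(i <- r | P i) F i \in C.
Proof.
by move=> FC; apply: (big_ind (fun x => x \in C)) => //; [exact: idealr0|exact: idealrD].
Qed.

End IdealClosed.

Lemma mcoeff_pihomog n (R : nzRingType) (p : {mpoly R[n]}) e m :
  (pihomog mdeg e p)@_m = if mdeg m == e then p@_m else 0.
Proof.
case: ifP => [/eqP me|/negbT ne]; last exact: (dhomog_nemf_coeff (pihomogP _ _ _) ne).
have [b pb] : exists b, (msize p <= b)%N /\ (e < b)%N.
  by exists (maxn (msize p) e.+1); rewrite leq_maxl leq_maxr.
rewrite [in RHS](pihomog_partitionE (mf := mdeg) pb.1) [RHS]raddf_sum /=.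
rewrite [RHS](bigD1 (Ordinal pb.2)) //= big1 ?addr0 // => i ni.
apply: (dhomog_nemf_coeff (pihomogP _ _ _)); change (mdeg m != i); rewrite me eq_sym.
by move: ni; rewrite -val_eqE.
Qed.

Section LastVariable.
Variables (n : nat) (R : comNzRingType).

Definition mrest : {mpoly R[n.+1]} -> {mpoly R[n]} :=
  mmap (@mpolyC n R) (fun i => if unlift ord_max i is Some j then 'X_j else 0).
HB.instance Definition _ := GRing.RMorphism.on mrest.

Lemma mrestC c : mrest c%:MP = c%:MP. Proof. exact: mmapC. Qed.

Lemma mrest_max : mrest 'X_ord_max = 0.
Proof. by rewrite /mrest mmapX mmap1U unlift_none. Qed.

Lemma mrest_widen i : mrest 'X_(widen i) = 'X_i.
Proof. by rewrite /mrest mmapX mmap1U widen_lift liftK. Qed.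

Lemma mwiden_widen i : mwiden 'X_i = 'X_(widen i) :> {mpoly R[n.+1]}.
Proof. by rewrite mwidenX mnmwiden1. Qed.

Lemma mrestK : cancel (@mwiden n R) mrest.
Proof.
move=> p; apply: (mpoly_morph_eq (f := mrest \o @mwiden n R) (g := idfun)) => [c|i] /=.
  by rewrite mwidenC mrestC.
by rewrite mwiden_widen mrest_widen.
Qed.

Lemma mrest_decomp p : exists h, p = mwiden (mrest p) + 'X_ord_max * h.
Proof.
have [||| | |h hE] := @mpoly_morph_mod n.+1 R {mpoly R[n.+1]} idfun (@mwiden n R \o mrest)
  (fun a => exists h, a = 'X_ord_max * h) _ _ _ _ _ p.
- by exists 0; rewrite mulr0.
- by move=> a b [h ->] [h' ->]; exists (h + h'); rewrite mulrDr.
- by move=> a b [h ->]; exists (a * h); rewrite mulrCA.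
- by move=> c; exists 0; rewrite /= mrestC mwidenC subrr mulr0.
- move=> i; case: (unliftP ord_max i) => [j ->|->] /=.
    by exists 0; rewrite -widen_lift mrest_widen mwiden_widen subrr mulr0.
  by exists 1; rewrite mrest_max mwiden0 subr0 mulr1.
by exists h; rewrite -hE /= addrC subrK.
Qed.

End LastVariable.

Section Independence.
Variables (k : finFieldType) (n : nat).
Implicit Types (C : {pred {mpoly k[n]}}) (b : nat -> {mpoly k[n]}).

(** Algebraic independence over [k] of the first [r] terms of [b] in the quotient by [C]. *)
Definition indep_mod r b C := forall p : {mpoly k[r]}, mpoly_at b p \in C -> p = 0.

(** Write a relation as [p0 + x_r h]. Modulo [C'] the element [z] vanishes, so [p0 = 0]; as [C] is
    prime and omits [z], [h] is again a relation modulo [C], of smaller degree. *)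
Lemma indep_mod_extend r b C C' z :
  idealr_closed C -> prime_idealr_closed C -> idealr_closed C' ->
  {subset C <= C'} -> z \in C' -> z \notin C -> indep_mod r b C' ->
  indep_mod r.+1 (fun i => if i == r then z else b i) C.
Proof.
move=> idC prC idC' sCC' zC' zC ind p; set b' := fun i => _.
have at_widen (q : {mpoly k[r]}) : mpoly_at b' (mwiden q) = mpoly_at b q :> {mpoly k[n]}.
  move: q; apply: (@mpoly_morph_eq r k {mpoly k[n]}
    (mmap (@mpolyC n k) (fun i : 'I_r.+1 => b' i) \o @mwiden r k)
    (mmap (@mpolyC n k) (fun i : 'I_r => b i))).
    by move=> c /=; rewrite mwidenC !mmapC.
  by move=> i /=; rewrite mwiden_widen !mmapX !mmap1U /b' /= ltn_eqF.
have at_max : mpoly_at b' 'X_(ord_max : 'I_r.+1) = z :> {mpoly k[n]}.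
  by rewrite /mpoly_at mmapX mmap1U /b' eqxx.
have [m] := ubnP (msize p); elim: m p => // m IHm p.
have [h pE] := mrest_decomp p; rewrite {2}pE => sp.
have -> : mpoly_at b' (mwiden (mrest p) + 'X_ord_max * h) =
    mpoly_at b (mrest p) + z * mpoly_at b' h.
  by rewrite -at_widen -at_max /mpoly_at rmorphD rmorphM.
move=> pC; have r0 : mrest p = 0.
  apply: ind; rewrite -[mpoly_at b _](addrK (z * mpoly_at b' h)).
  by apply: (idealrB idC'); [exact: sCC'|rewrite mulrC idealrMl].
have at0 : mpoly_at b (0 : {mpoly k[r]}) = 0 by apply: mmap0.
have pE' : p = 'X_ord_max * h by rewrite {1}pE r0 mwiden0 add0r.
move: pC; rewrite r0 at0 add0r => /prC; rewrite (negPf zC) /= => hC.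
rewrite pE'; case: (eqVneq h 0) => [->|h0]; first by rewrite mulr0.
rewrite (IHm h) ?mulr0 //; move: sp; rewrite pE' msizeM ?msizeX ?mdeg1 //.
by rewrite -msize_poly_eq0 msizeX.
Qed.

Lemma prime_chain_indep m (D : nat -> {pred {mpoly k[n]}}) :
  (forall i, (i <= m)%N -> idealr_closed (D i)) ->
  (forall i, (i < m)%N -> prime_idealr_closed (D i)) ->
  (forall i, (i < m)%N -> {subset D i <= D i.+1} /\ exists2 p, p \in D i.+1 & p \notin D i) ->
  exists b, indep_mod m b (D 0%N).
Proof.
elim: m D => [|m IHm] D idD prD sD.
  exists (fun=> 0) => p; rewrite (nvar0_mpolyC p) /mpoly_at mmapC => pD.
  case: (eqVneq (p@_0) 0) => [->|p0]; first by rewrite mpolyC0.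
  case: (idD 0%N) => // _ /negP[]; rewrite -(mpolyC1 n k) -(mulVf p0) mpolyCM.
  by apply: idealrMl => //; apply: idD.
have [i|i|i|b ind] := IHm (fun i => D i.+1).
- exact: (idD i.+1).
- exact: (prD i.+1).
- exact: (sD i.+1).
have [s01 [z z1 z0]] := sD 0%N isT.
exists (fun i => if i == m then z else b i).
apply: (@indep_mod_extend m b (D 0%N) (D 1%N) z) => //.
- exact: (idD 0%N isT).
- exact: (prD 0%N isT).
- exact: (idD 1%N isT).
Qed.

Lemma prime_chain_length m (D : nat -> {pred {mpoly k[n]}}) :
  (forall i, (i <= m)%N -> idealr_closed (D i)) ->
  (forall i, (i < m)%N -> prime_idealr_closed (D i)) ->
  (forall i, (i < m)%N -> {subset D i <= D i.+1} /\ exists2 p, p \in D i.+1 & p \notin D i) ->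
  (m <= n)%N.
Proof.
move=> idD prD sD; have [b ind] := prime_chain_indep idD prD sD.
rewrite leqNgt; apply/negP=> /(algebraic_dependence b)[p p0 pb0].
by case/eqP: p0; apply: ind; rewrite pb0; apply: idealr0; apply: idD.
Qed.

End Independence.

Section UpperBound.
Variables (k : finFieldType) (n : nat).
Local Notation S := {mpoly k[n.+1]}.

(** The chain is prolonged to [0 < Q < C 0 < ... < C l < M], with [M] the polynomials without
    constant term. [C l] lies in [M] because it is homogeneous and proper, and strictly so because a
    point omits some variable. *)
Lemma point_chain_length (X : subscheme k n) (Q : {pred S}) F l C :
  idealr_closed Q -> prime_idealr_closed Q -> F \notin Q -> X F ->
  (exists2 L, L \in Q & L != 0) ->
  (forall P, point_of X P -> {subset Q <= P}) ->
  point_chain X l C -> (l.+3 <= n.+1)%N.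
Proof.
move=> idQ prQ FQ XF [L LQ L0] sQ [ptC sC].
pose M : {pred S} := fun p => p@_0 == 0.
have idC i : (i <= l)%N -> idealr_closed (C i) by move=> /ptC[[]].
have prC i : (i <= l)%N -> prime_idealr_closed (C i) by move=> /ptC[[]].
have idM : idealr_closed M.
  split; rewrite -?topredE /= ?/M; first by rewrite mcoeff0.
    by rewrite mcoeff1 eqxx oner_neq0.
  move=> a u v; rewrite -!topredE /= /M => /eqP u0 /eqP v0.
  by rewrite mcoeffD (rmorphM (mcoeff 0%MM)) /= u0 v0 mulr0 addr0.
have [[_ _ homC [i Xi]] _] := ptC l (leqnn l).
pose D j : {pred S} := match j with
  | 0 => pred1 0 | 1 => Q | j'.+2 => if (j' <= l)%N then C j' else M end.
apply: (@prime_chain_length k n.+1 l.+3 D).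
- case=> [|[|j]] // _.
    split; rewrite -?topredE /= ?eqxx ?oner_neq0 // => a u v.
    by rewrite -!topredE /= => /eqP-> /eqP->; rewrite mulr0 addr0.
  by rewrite /D; case: ifP => // /idC.
- case=> [|[|j]] // jl u v.
    by rewrite -!topredE /= mulf_eq0.
  by rewrite /D (jl : (j <= l)%N); apply: prC.
case=> [|[|j]] jl.
- split; last by exists L; rewrite // -topredE /= L0.
  by move=> p; rewrite -topredE /= => /eqP->; apply: idealr0.
- split; first by apply: sQ; apply: ptC.
  by exists F => //; have [_ ->] := ptC 0%N isT.
rewrite /D (jl : (j <= l)%N); move: jl; rewrite !ltnS leq_eqVlt => /predU1P[->|jl]; last first.
  by rewrite jl; apply: sC.
rewrite ltnn; split; last first.
  by exists 'X_i => //; rewrite -topredE /= /M mcoeffX mnm1_eq0.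
move=> p /(homC _ 0%N) pC; rewrite -topredE /= /M; apply/negPn/negP => p0.
case: (idC l (leqnn l)) => _ /negP[].
have E : pihomog mdeg 0 p = (p@_0)%:MP.
  apply/mpolyP=> m; rewrite mcoeff_pihomog mcoeffC mdeg_eq0.
  by case: eqP => [->|_]; rewrite ?mulr1 ?mulr0.
have -> : 1 = (p@_0)^-1%:MP * pihomog mdeg 0 p.
  by rewrite E -mpolyCM mulVf // mpolyC1.
by apply: (idealrMl (idC l (leqnn l))).
Qed.

End UpperBound.

(** * Chains of primes in [k[x_0, ..., x_m][t]] *)

Lemma irreducible_ndvdC (R : idomainType) (g : {poly R}) a :
  irreducible_poly g -> a != 0 -> ~~ (g %| a%:P).
Proof.
move=> [g1 _] a0; apply: contraL g1 => /dvdp_leq.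
by rewrite polyC_eq0 a0 size_polyC a0 -leqNgt; apply.
Qed.

(* The reductions of the multiples of [g] generate an ideal over the fraction field of [R'], which is
   proper because a constant reduction would be coprime to the reduction of [f]. *)
Lemma lying_over (R R' : idomainType) (rho : {rmorphism R -> R'}) (w : R' -> R)
    (f g : {poly R}) :
  cancel w rho -> f \is monic -> irreducible_poly g -> g %| f ->
  exists2 g' : {poly R'}, irreducible_poly g'
    & forall c, g %| c -> g' %| map_poly rho c.
Proof.
move=> wK monf irr gf.
have f1 : (1 < size f)%N.
  by case: irr => g1 _; apply: leq_trans g1 _; apply: dvdp_leq; rewrite ?monic_neq0.
pose lift (p : {poly R'}) : {poly R} := \poly_(i < size p) w p`_i.
have liftK p : map_poly rho (lift p) = p.
  apply/polyP=> i; rewrite coef_map /= coef_poly.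
  by case: ltnP => si; rewrite ?wK // rmorph0 nth_default.
(* Euclidean descent on the size of the reduction of a multiple [c] of [g]. Preimages chosen by [w]
   and [lift] show that a pseudo-remainder of two reductions is itself the reduction of a multiple
   of [g]. *)
have main N c : (size (map_poly rho c) < N)%N -> g %| c -> map_poly rho c != 0 ->
    exists2 g' : {poly R'}, irreducible_poly g' & forall c, g %| c -> g' %| map_poly rho c.
  elim: N c => // N IHN c sc gc c0.
  case: (classic (exists2 c1, g %| c1 & ~~ (map_poly rho c %| map_poly rho c1))).
    case=> c1 gc1 nd; pose r := map_poly rho c1 %% map_poly rho c.
    pose q := lift (map_poly rho c1 %/ map_poly rho c).
    pose a := w (lead_coef (map_poly rho c) ^+ scalp (map_poly rho c1) (map_poly rho c)).
    have cE : map_poly rho (a%:P * c1 - q * c) = r.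
      rewrite rmorphB !rmorphM /= map_polyC /= wK liftK mul_polyC.
      by rewrite Pdiv.Idomain.divp_eq addrC addKr.
    apply: (IHN (a%:P * c1 - q * c)).
    - by rewrite cE; apply: (@leq_trans (size (map_poly rho c))); rewrite ?ltn_modp.
    - by apply: dvdp_sub; apply: dvdp_mull.
    - by rewrite cE.
  move=> nex; have dvd c1 : g %| c1 -> map_poly rho c %| map_poly rho c1.
    by move=> gc1; apply: contra_notT nex => nd; exists c1.
  case: (ltnP 1 (size (map_poly rho c))) => c_1.
    have [g' irr' g'c] := exists_irreducible_factor c_1.
    by exists g' => // c1 /dvd; apply: dvdp_trans.
  have cop : coprimep f c.
    apply: (coprimep_specialize (phi := rho)) => //.
    have /eqp_coprimepr-> : map_poly rho c %= 1.
      by rewrite -size_poly_eq1 eqn_leq c_1 size_poly_gt0.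
    exact: coprimep1.
  have := Pdiv.Idomain.coprimepP _ _ cop g gf gc.
  by rewrite -size_poly_eq1 => /eqP g1; case: irr; rewrite g1.
apply: (main _ f (ltnSn _) gf).
by rewrite monic_neq0 // monic_map.
Qed.

Definition multiples (R : idomainType) (g : {poly R}) : {pred {poly R}} := fun p => g %| p.

Lemma multiplesE (R : idomainType) (g p : {poly R}) : (p \in multiples g) = (g %| p).
Proof. by []. Qed.

Definition preim_pred (R S : Type) (phi : R -> S) (C : {pred S}) : {pred R} :=
  fun p => phi p \in C.

Lemma preim_predE (R S : Type) (phi : R -> S) (C : {pred S}) p :
  (p \in preim_pred phi C) = (phi p \in C).
Proof. by []. Qed.

Section DvdIdeal.
Variables (R : idomainType) (g : {poly R}).
Hypothesis irr : irreducible_poly g.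

Lemma dvdp_idealr_closed : idealr_closed (multiples g).
Proof.
split; rewrite ?(multiplesE, preim_predE) ?dvdp0 //.
  by rewrite -polyC1 irreducible_ndvdC ?oner_neq0.
by move=> a u v; rewrite !(multiplesE, preim_predE) => gu gv; rewrite dvdp_add ?dvdp_mull.
Qed.

Lemma dvdp_prime_idealr_closed : prime_idealr_closed (multiples g).
Proof. by move=> u v; rewrite !(multiplesE, preim_predE) irreducible_dvdpM. Qed.

End DvdIdeal.

Lemma preim_idealr_closed (R S : nzRingType) (phi : {rmorphism R -> S}) (C : {pred S}) :
  idealr_closed C -> idealr_closed (preim_pred phi C).
Proof.
case=> C0 C1 CM; split; rewrite ?(multiplesE, preim_predE) ?rmorph0 ?rmorph1 //.
by move=> a u v uC vC; rewrite preim_predE rmorphD rmorphM; apply: CM.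
Qed.

(** The chain starts with the multiples of [g] and continues with preimages of a chain obtained
    after setting the last variable to 0, where [lying_over] supplies a new [g]. The variable [x_0]
    is never set to 0, which keeps the primes away from the irrelevant ideal. Strictness is
    witnessed by variables so that it survives the passage to homogeneous parts. *)
Lemma exists_prime_chain (k : fieldType) m (f g : {poly {mpoly k[m.+1]}}) :
  f \is monic -> irreducible_poly g -> g %| f ->
  exists C : nat -> {pred {poly {mpoly k[m.+1]}}},
    [/\ forall i, (i <= m)%N -> idealr_closed (C i) /\ prime_idealr_closed (C i),
        forall p, g %| p -> p \in C 0%N,
        forall i, (i < m)%N -> {subset C i <= C i.+1} /\
          exists2 j, ('X_j)%:P \in C i.+1 & ('X_j)%:P \notin C i
      & exists j, forall i, (i <= m)%N -> ('X_j)%:P \notin C i].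
Proof.
have X0 m' (j : 'I_m'.+1) : 'X_j != 0 :> {mpoly k[m'.+1]}.
  by rewrite -msize_poly_eq0 msizeX.
elim: m f g => [|m IHm] f g monf irr gf.
  exists (fun=> multiples g); split=> //.
    by move=> i _; split; [exact: dvdp_idealr_closed | exact: dvdp_prime_idealr_closed].
  by exists ord0 => i _; rewrite multiplesE irreducible_ndvdC ?X0.
have [g' irr' gg'] := lying_over (rho := @mrest m.+1 k) (@mrestK m.+1 k) monf irr gf.
have monf' : map_poly (@mrest m.+1 k) f \is monic by rewrite monic_map.
have [C [idC C0 sC [j jC]]] := IHm (map_poly (@mrest m.+1 k) f) g' monf' irr' (gg' f gf).
exists (fun i => if i is i'.+1 then preim_pred (map_poly (@mrest m.+1 k)) (C i')
  else (multiples g)).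
have rX i : map_poly (@mrest m.+1 k) ('X_(widen i))%:P = ('X_i)%:P.
  by rewrite map_polyC /= mrest_widen.
split.
- case=> [|i] im; first by split; [exact: dvdp_idealr_closed | exact: dvdp_prime_idealr_closed].
  have [idCi prCi] := idC i im.
  split; first exact: (preim_idealr_closed (map_poly (@mrest m.+1 k)) idCi).
  by move=> u v; rewrite !preim_predE rmorphM; apply: prCi.
- by move=> p; rewrite (multiplesE, preim_predE).
- case=> [|i] im.
    split; first by move=> p; rewrite !(multiplesE, preim_predE) => /gg'/C0.
    exists ord_max; last by rewrite multiplesE irreducible_ndvdC ?X0.
    by rewrite (multiplesE, preim_predE) map_polyC /= mrest_max; have [[]] := idC 0%N isT.
  have [sCi [j' j1 j2]] := sC i im; split; first by move=> p; rewrite !(multiplesE, preim_predE); apply: sCi.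
  by exists (widen j'); rewrite (multiplesE, preim_predE) rX.
exists (widen j) => -[|i] im; first by rewrite multiplesE irreducible_ndvdC ?X0.
by rewrite preim_predE rX; apply: jC.
Qed.

(** * Homogeneous components and homogeneous primes *)

Section Grading.
Variables (n : nat) (R : comNzRingType).
Implicit Types p q : {mpoly R[n]}.

(* [x_i |-> x_i s], so that the coefficient of [s ^ e] is the component of degree [e]. *)
Definition grade : {mpoly R[n]} -> {poly {mpoly R[n]}} :=
  mmap (polyC \o @mpolyC n R) (fun i => ('X_i)%:P * 'X).
HB.instance Definition _ := GRing.RMorphism.on grade.

Lemma coef_grade p e : (grade p)`_e = pihomog mdeg e p.
Proof.
rewrite /grade /mmap coef_sum pihomogE [RHS]big_mkcond; apply: eq_bigr => m _.
have -> : mmap1 (fun i => ('X_i)%:P * 'X) m = ('X_[m])%:P * 'X^(mdeg m) :> {poly {mpoly R[n]}}.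
  rewrite mdegE mpolyXE_id rmorph_prod /= -[in RHS]prodrXr -big_split /=.
  by apply: eq_bigr => i _; rewrite exprMn rmorphXn.
rewrite /= mulrA -rmorphM /= coefCM coefXn mul_mpolyC eq_sym.
rewrite -[RHS]/(if mdeg m == e then _ else _).
by case: eqP => _; rewrite ?mulr1 ?mulr0.
Qed.

Lemma pihomogM p q e :
  pihomog mdeg e (p * q) = \sum_(i < e.+1) pihomog mdeg i p * pihomog mdeg (e - i) q.
Proof.
have gM : grade (p * q) = grade p * grade q by apply: rmorphM.
have H := coef_grade (p * q) e; rewrite gM in H; refine (eq_trans (esym H) _).
rewrite coefM; apply: eq_bigr => i _; congr (_ * _); exact: coef_grade.
Qed.

End Grading.

(** Gauss's lemma: if [i] and [j] are the least indices with [u i] and [v j] outside [C], then the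
    sum of index [i + j] is [u i * v j] modulo [C]. *)
Lemma prime_coef_mul (R : comNzRingType) (C : {pred R}) (u v : nat -> R) :
  idealr_closed C -> prime_idealr_closed C ->
  (forall e : nat, \sum_(i < e.+1) u i * v (e - i)%N \in C) ->
  forall a b, (u a \in C) || (v b \in C).
Proof.
move=> idC prC uvC a b; apply/negPn; rewrite negb_or; apply/negP=> /andP[ua vb].
have exu : exists i, u i \notin C by exists a.
have exv : exists i, v i \notin C by exists b.
case: (ex_minnP exu) => i ui mini; case: (ex_minnP exv) => j vj minj.
have le_ij : (i < (i + j).+1)%N by rewrite ltnS leq_addr.
have: u i * v j \in C.
  have := uvC (i + j)%N; rewrite (bigD1 (Ordinal le_ij)) //= addKn => uvC'.
  rewrite -[u i * v j](addrK (\sum_(l < (i + j).+1 | l != Ordinal le_ij) u l * v (i + j - l)%N)).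
  apply: (idealrB idC) => //; apply: (idealr_sum idC) => l nl.
  have {nl} : l != i :> nat by rewrite -val_eqE in nl.
  case: ltngtP => // [li|il] _.
    rewrite mulrC; apply: (idealrMl idC); apply: contraLR li => /mini.
    by rewrite -leqNgt.
  apply: (idealrMl idC); apply: contraLR il => /minj.
  have ll : (l <= i + j)%N by rewrite -ltnS.
  by rewrite -leqNgt leq_subRL // leq_add2r.
by move/prC; rewrite (negPf ui) (negPf vj).
Qed.

Section HomogeneousCore.
Variables (k : fieldType) (n : nat) (T : comNzRingType).
Variables (phi : {rmorphism {mpoly k[n.+1]} -> T}) (C : {pred T}).
Hypotheses (idC : idealr_closed C) (prC : prime_idealr_closed C).

(** The largest homogeneous ideal inside the preimage of [C]. Components of degree at least
    [msize p] vanish, so a finite test suffices. *)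
Definition homog_core : {pred {mpoly k[n.+1]}} :=
  fun p => all (fun e => phi (pihomog mdeg e p) \in C) (iota 0 (msize p)).

Lemma homog_coreP p : reflect (forall e, phi (pihomog mdeg e p) \in C) (p \in homog_core).
Proof.
apply: (iffP allP) => [h e|h e _]; last exact: h.
case: (ltnP e (msize p)) => pe; first by apply: h; rewrite mem_iota.
suff -> : pihomog mdeg e p = 0 by rewrite rmorph0; exact: idealr0.
apply/mpolyP=> m; rewrite mcoeff_pihomog mcoeff0; case: eqP => // me.
by apply/memN_msupp_eq0/msize_mdeg_ge; rewrite me.
Qed.

Lemma homog_core_homog p e : p \is e.-homog -> (p \in homog_core) = (phi p \in C).
Proof.
move=> hp; apply/homog_coreP/idP => [/(_ e)|pC e']; first by rewrite (pihomog_dE hp).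
case: (eqVneq e e') => [<-|ne]; first by rewrite (pihomog_dE hp).
by rewrite (pihomog_ne0 ne hp) rmorph0; exact: idealr0.
Qed.

Lemma homog_core_point : (exists i, phi 'X_i \notin C) -> proj_point homog_core.
Proof.
case=> i Xi; split.
- split.
  + by apply/homog_coreP=> e; rewrite pihomog0 rmorph0; apply: idealr0.
  + rewrite (@homog_core_homog 1 0%N) ?rmorph1; last exact: dhomog1.
    by case: idC.
  move=> a u v /homog_coreP uC /homog_coreP vC; apply/homog_coreP=> e.
  rewrite pihomogD pihomogM rmorphD rmorph_sum; apply: idealrD => //.
  by apply: idealr_sum => // j _; rewrite rmorphM; apply: idealrMl.
- move=> u v /homog_coreP uvC; case: (boolP (u \in homog_core)) => //= uC.
  apply/homog_coreP=> b; apply: contraNT uC => vb; apply/homog_coreP=> a.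
  have := @prime_coef_mul T C (fun i => phi (pihomog mdeg i u))
    (fun i => phi (pihomog mdeg i v)) idC prC _ a b.
  rewrite (negPf vb) orbF; apply=> e.
  by have := uvC e; rewrite pihomogM rmorph_sum; under eq_bigr do rewrite rmorphM.
- move=> p e /homog_coreP pC; rewrite (homog_core_homog (pihomogP _ _ _)); exact: pC.
by exists i; rewrite (homog_core_homog (e := 1%N)) // dhomogX; apply/eqP; apply: mdeg1.
Qed.

End HomogeneousCore.

Lemma homog1_sum (k : comNzRingType) n (l : {mpoly k[n]}) :
  l \is 1.-homog -> l = \sum_i l@_U_(i) *: 'X_i.
Proof.
move=> hl; apply/mpolyP=> m; rewrite raddf_sum /=.
under eq_bigr do rewrite mcoeffZ mcoeffX.
case: (boolP (m \in msupp l)) => [ml|/[dup] ml /memN_msupp_eq0 ->].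
  have /mdeg1P[i /eqP->] : mdeg m == 1%N by rewrite (homog_mdeg hl ml).
  rewrite (bigD1 i) //= eqxx mulr1 big1 ?addr0 // => j ji.
  by rewrite eq_mnm1 (negPf ji) mulr0.
rewrite big1 // => i _; case: eqP => [mi|]; rewrite ?mulr0 //.
by rewrite mi (memN_msupp_eq0 ml) mul0r.
Qed.

(** The points are the homogeneous cores of the primes lying over the coordinate primes. Linear
    forms that map to the variables show that the cores stay distinct and do not contain the
    irrelevant ideal. *)
Lemma exists_point_chain (k : fieldType) m (X : subscheme k m.+2)
    (phi : {rmorphism {mpoly k[m.+3]} -> {poly {mpoly k[m.+1]}}}) f :
  f \is monic -> (1 < size f)%N ->
  (forall p e, X p -> f %| phi (pihomog mdeg e p)) ->
  (forall j, exists2 l, l \is 1.-homog & phi l = ('X_j)%:P) ->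
  exists C, point_chain X m C.
Proof.
move=> monf f1 Xf surj.
have [g irr gf] := exists_irreducible_factor f1.
have [C [idC C0 sC [j0 j0C]]] := exists_prime_chain monf irr gf.
exists (fun i => homog_core phi (C i)); split.
  move=> i im; have [idCi prCi] := idC i im; split.
    apply: homog_core_point => //; have [l hl phil] := surj j0.
    apply/existsP; apply: contraNT (j0C i im) => /existsPn XC.
    rewrite -phil (homog1_sum hl) rmorph_sum; apply: (idealr_sum idCi) => j _.
    rewrite -mul_mpolyC rmorphM; apply: (idealrMl idCi).
    by apply: contraNT (XC j) => ->.
  move=> p Xp; apply/(homog_coreP _ idCi) => e.
  have: phi (pihomog mdeg e p) \in C 0%N.
    by apply: C0; apply: dvdp_trans gf _; apply: Xf.
  elim: i im {idCi prCi} => // i IHi im /(IHi (ltnW im)).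
  by have [sCi _] := sC i im; apply: sCi.
move=> i im; have [sCi [j j1 j2]] := sC i im.
have [idCi prCi] := idC i (ltnW im); have [idCi1 _] := idC i.+1 im.
split; first by move=> p /(homog_coreP _ idCi) pC; apply/(homog_coreP _ idCi1) => e; apply: sCi.
have [l hl phil] := surj j; exists l; rewrite (homog_core_homog _ _ hl) ?phil //.
Qed.

(** * Leading coefficients in [t] and adapted coordinates *)

Section TopCoefficient.
Variables (R T : comNzRingType) (n : nat).
Variables (iota : {rmorphism R -> T}) (phi : {rmorphism {mpoly R[n]} -> {poly T}}).
Variables (v : 'I_n -> R) (a : 'I_n -> T).
Hypothesis phiC : forall c, phi c%:MP = (iota c)%:P.
Hypothesis phiX : forall i, phi 'X_i = (iota (v i))%:P * 'X + (a i)%:P.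

Let top e (u : {poly T}) c := (size u <= e.+1)%N /\ u`_e = c.

Let topM e e' u u' c c' : top e u c -> top e' u' c' -> top (e + e') (u * u') (c * c').
Proof.
move=> [su ue] [su' ue']; split.
  apply: leq_trans (size_polyMleq _ _) _.
  by have := leq_add su su'; case: (size u + size u')%N => //= s; rewrite addnS addSn.
rewrite coefM (bigD1 (Ordinal (leq_addr e' e : (e < (e + e').+1)%N))) //= ue addKn ue'.
rewrite big1 ?addr0 // => i; rewrite -val_eqE /=.
case: ltngtP => // ei _.
  rewrite [u'`_ _]nth_default ?mulr0 //; apply: leq_trans su' _.
  by rewrite ltn_subRL ltn_add2r.
by rewrite nth_default ?mul0r //; apply: leq_trans su _.
Qed.

Lemma dhomog_top F d : F \is d.-homog ->
  (size (phi F) <= d.+1)%N /\ (phi F)`_d = iota F.@[v].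
Proof.
move=> hF.
have topX m : top (mdeg m) (phi 'X_[m]) (iota ('X_[m]).@[v]).
  rewrite mevalX mdegE mpolyXE_id !rmorph_prod /=.
  elim/big_ind3: _ => [|e u c e' u' c'|i _].
  - by split; rewrite ?size_poly1 // coef1.
  - exact: topM.
  rewrite !rmorphXn; elim: (m i) => [|e IHe].
    by split; rewrite ?expr0 ?size_poly1 // coef1.
  rewrite !exprS -add1n; apply: topM IHe.
  rewrite phiX; split.
    apply: leq_trans (size_polyD _ _) _; rewrite geq_max (leq_trans (size_polyC_leq1 _)) // andbT.
    apply: leq_trans (size_polyMleq _ _) _; rewrite size_polyX addn2 /=.
    by rewrite ltnS size_polyC_leq1.
  by rewrite coefD coefC addr0 coefCM coefX mulr1.
rewrite {1 2}(mpolyE F) mevalE !rmorph_sum /= -/(top d _ _) big_seq [X in top _ _ X]big_seq.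
elim/big_ind2: _ => [|c u c' u' [su ue] [su' ue']|m mF].
- by split; rewrite ?size_poly0 // coef0.
- split; last by rewrite coefD ue ue'.
  by apply: leq_trans (size_polyD _ _) _; rewrite geq_max su.
rewrite -mul_mpolyC !rmorphM phiC -mevalX -(homog_mdeg hF mF) -[mdeg m]add0n.
apply: topM (topX m); split; last by rewrite coefC.
exact: size_polyC_leq1.
Qed.

Lemma dhomog_top_monic F d : F \is d.-homog -> F.@[v] = 1 ->
  phi F \is monic /\ size (phi F) = d.+1.
Proof.
move=> hF F1; have [sF] := dhomog_top hF; rewrite F1 rmorph1 => tF.
have sE : size (phi F) = d.+1.
  apply/eqP; rewrite eqn_leq sF /= ltnNge; apply: contra_eqN tF => sd.
  by rewrite nth_default // eq_sym oner_neq0.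
by split=> //; rewrite monicE lead_coefE sE tF.
Qed.

End TopCoefficient.

Section Frames.
Variable k : fieldType.

(** A row of rank 1 is a scalar multiple of the first row of its extended row base; rescaling that
    base gives [U]. *)
Lemma complete_row n (P : 'rV[k]_n.+1) : P != 0 ->
  exists2 U : 'M[k]_n.+1, U \in unitmx & row 0 U = P.
Proof.
move=> P0; have rP : \rank P = 1%N.
  by apply/eqP; rewrite eqn_leq rank_leq_row lt0n mxrank_eq0.
have := mulmx_ebase P; rewrite rP [col_ebase P]mx11_scalar mul_scalar_mx => PE.
have c0 : col_ebase P 0 0 != 0.
  by have := col_ebase_unit P; rewrite unitmxE det_mx11 unitfE.
exists (col_ebase P 0 0 *: row_ebase P).
  by rewrite unitmxE detZ unitfE mulf_neq0 ?expf_neq0 // -unitfE -unitmxE row_ebase_unit.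
rewrite -[in RHS]PE -scalemxAl linearZ /=; congr (_ *: _).
rewrite rowE; congr (_ *m _); apply/rowP=> j.
by rewrite !mxE /= andbT eq_sym -val_eqE.
Qed.

(** The rows of [U] form a basis that starts with [P] and of which only the second vector lies off
    the hyperplane [l = 0]. One completes [P] to a basis, then changes the other vectors by a basis
    dual to the restriction of [l]. *)
Lemma adapted_frame n (P : 'rV[k]_(1 + n.+1)) (l : 'cV[k]_(1 + n.+1)) :
  P != 0 -> l != 0 -> P *m l = 0 ->
  exists U : 'M[k]_(1 + n.+1), [/\ U \in unitmx, row 0 U = P
    & U *m l = delta_mx (rshift 1 0) 0].
Proof.
move=> P0 l0 Pl; have [U1 uU1 rU1] := complete_row P0.
pose l1 : 'cV[k]_(1 + n.+1) := U1 *m l.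
have l1u : usubmx l1 = 0.
  apply/rowP=> j; rewrite !ord1; transitivity ((row 0 U1 *m l) 0 0).
    by rewrite -row_mul !mxE; apply: eq_bigr => i _; congr (U1 _ _ * _); apply/val_inj.
  by rewrite rU1 Pl !mxE.
have mu0 : (dsubmx l1)^T != 0.
  apply: contraNneq l0 => mu0; have : l1 = 0.
    by rewrite -[l1]vsubmxK l1u -[dsubmx l1]trmxK mu0 trmx0 col_mx0.
  by move/(congr1 (mulmx (invmx U1))); rewrite mulKmx // mulmx0 => ->.
have [W uW rW] := complete_row mu0.
pose V := invmx W^T.
have Vmu : V *m dsubmx l1 = delta_mx 0 0.
  have -> : dsubmx l1 = W^T *m delta_mx 0 0.
    by rewrite -[LHS]trmxK -rW rowE trmx_mul trmx_delta.
  by rewrite mulKmx // unitmx_tr.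
exists (block_mx 1%:M 0 0 V *m (U1 : 'M[k]_(1 + n.+1, 1 + n.+1))); split.
- rewrite unitmx_mul uU1 andbT unitmxE det_ublock det1 mul1r -unitmxE.
  by rewrite unitmx_inv unitmx_tr.
- rewrite row_mul -rU1 [row 0 U1]rowE; congr (_ *m _).
  apply/rowP=> j; rewrite mxE.
  transitivity (block_mx 1%:M 0 0 V (lshift n.+1 0) j).
    by congr (fun_of_matrix _ _ _); apply/val_inj.
  case: (split_ordP j) => i ->; rewrite ?block_mxEul ?block_mxEur !mxE -?val_eqE /=.
    by rewrite ord1.
  by [].
rewrite -mulmxA -/l1 -[l1]vsubmxK l1u mul_block_col !mul0mx !mulmx0 !add0r Vmu.
by rewrite delta_mx_dshift.
Qed.

End Frames.

(** * Restriction to a hyperplane and the dimension of the section *)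

Section LinearForm.
Variables (R : comNzRingType) (n : nat).

Definition linform (w : 'I_n -> R) : {mpoly R[n]} := \sum_i w i *: 'X_i.

Lemma linform_homog w : linform w \is 1.-homog.
Proof. by apply: rpred_sum => i _; apply: rpredZ; rewrite dhomogX; apply/eqP; apply: mdeg1. Qed.

Lemma morph_linform (T : comNzRingType) (phi : {rmorphism {mpoly R[n]} -> T}) w :
  phi (linform w) = \sum_i phi (w i)%:MP * phi 'X_i.
Proof.
by rewrite rmorph_sum; apply: eq_bigr => i _; rewrite -mul_mpolyC rmorphM.
Qed.

Lemma meval_linform w v : (linform w).@[v] = \sum_i w i * v i.
Proof. by rewrite morph_linform; apply: eq_bigr => i _; rewrite /= mevalC mevalXU. Qed.

Lemma linform_neq0 w : (exists i, w i != 0) -> linform w != 0.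
Proof.
case=> i; apply: contraNneq => /(congr1 (mcoeff U_(i))).
rewrite mcoeff0 raddf_sum (bigD1 i) //= mcoeffZ mcoeffXU eqxx mulr1 big1 ?addr0 => [->//|j ji].
by rewrite mcoeffZ mcoeffXU (negPf ji) mulr0.
Qed.

Variables (w e : 'I_n -> R).
Hypothesis we : \sum_i w i * e i = 1.

(* Projection along [e] onto the hyperplane [linform w = 0], acting on functions. *)
Definition hproj : {mpoly R[n]} -> {mpoly R[n]} :=
  mmap (@mpolyC n R) (fun i => 'X_i - e i *: linform w).
HB.instance Definition _ := GRing.RMorphism.on hproj.

Lemma hprojC c : hproj c%:MP = c%:MP. Proof. exact: mmapC. Qed.

Lemma hprojX i : hproj 'X_i = 'X_i - e i *: linform w.
Proof. by rewrite /hproj mmapX mmap1U. Qed.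

Lemma hproj_linform : hproj (linform w) = 0.
Proof.
rewrite morph_linform; under eq_bigr do rewrite /= hprojC hprojX mulrBr.
rewrite sumrB.
have -> : \sum_i (w i)%:MP * 'X_i = linform w by apply: eq_bigr => i _; rewrite mul_mpolyC.
have -> : \sum_i (w i)%:MP * (e i *: linform w) = linform w; last by rewrite subrr.
under eq_bigr do rewrite mul_mpolyC scalerA.
by rewrite -scaler_suml we scale1r.
Qed.

Lemma morph_hproj (T : comNzRingType) (phi : {rmorphism {mpoly R[n]} -> T}) p :
  phi (linform w) = 0 -> phi (hproj p) = phi p.
Proof.
move=> phiw; move: p; apply: (mpoly_morph_eq (f := phi \o hproj) (g := phi)) => [c|i] /=.
  by rewrite hprojC.
by rewrite hprojX rmorphB /= -mul_mpolyC rmorphM phiw mulr0 subr0.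
Qed.

Lemma hproj_mod p : exists c, p - hproj p = c * linform w.
Proof.
move: p; apply: (@mpoly_morph_mod n R {mpoly R[n]} idfun hproj
  (fun a => exists c, a = c * linform w)).
- by exists 0; rewrite mul0r.
- by move=> a b [c ->] [c' ->]; exists (c + c'); rewrite mulrDl.
- by move=> a b [c ->]; exists (a * c); rewrite mulrA.
- by move=> c; exists 0; rewrite /= hprojC subrr mul0r.
by move=> i; exists (e i)%:MP; rewrite /= hprojX opprB addrC subrK mul_mpolyC.
Qed.

End LinearForm.

Section FrameMorphism.
Variables (k : fieldType) (m : nat) (U : 'M[k]_(1 + (m.+1).+1)).

(** Row 1 is skipped: in an adapted frame the remaining rows span the hyperplane, so that
    [frame_morph] restricts functions to it, with [t] the coordinate along row 0. *)
Let idx (j : 'I_m.+1) : 'I_(1 + (m.+1).+1) := rshift 1 (lift 0 j).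

Definition frame_coef i : {mpoly k[m.+1]} := \sum_j U (idx j) i *: 'X_j.

Definition frame_morph : {mpoly k[m.+3]} -> {poly {mpoly k[m.+1]}} :=
  mmap (polyC \o @mpolyC m.+1 k)
    (fun i => (U 0 i)%:MP%:P * 'X + (frame_coef i)%:P).
HB.instance Definition _ := GRing.RMorphism.on frame_morph.

Lemma frame_morphC c : frame_morph c%:MP = (c%:MP)%:P. Proof. exact: mmapC. Qed.

Lemma frame_morphX i : frame_morph 'X_i = (U 0 i)%:MP%:P * 'X + (frame_coef i)%:P.
Proof. by rewrite /frame_morph mmapX mmap1U. Qed.

Lemma frame_morph_linform (w : 'cV[k]_(1 + (m.+1).+1)) :
  frame_morph (linform (fun i => w i 0)) =
  ((U *m w) 0 0)%:MP%:P * 'X + (\sum_j (U *m w) (idx j) 0 *: 'X_j)%:P.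
Proof.
have E i : frame_morph (w i 0)%:MP * frame_morph 'X_i =
    (U 0 i * w i 0)%:MP%:P * 'X + (w i 0 *: frame_coef i)%:P.
  rewrite frame_morphC frame_morphX mulrDr mulrA; congr (_ * _ + _).
    by rewrite mulrC -polyCM -mpolyCM.
  by rewrite -polyCM mul_mpolyC.
rewrite morph_linform; under eq_bigr => i _ do rewrite /= E.
rewrite big_split /= -mulr_suml; congr (_ * _ + _).
  by rewrite mxE !rmorph_sum.
rewrite -rmorph_sum /=; congr _%:P; rewrite /frame_coef.
under eq_bigr do rewrite scaler_sumr.
rewrite exchange_big; apply: eq_bigr => j _ /=; rewrite mxE scaler_suml.
by apply: eq_bigr => i _; rewrite scalerA mulrC.
Qed.

End FrameMorphism.

Lemma pihomog_mulr_homog (R : comNzRingType) n (c F : {mpoly R[n]}) d e :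
  F \is d.-homog -> exists c', pihomog mdeg e (c * F) = c' * F.
Proof.
move=> hF; rewrite pihomogM.
apply: (big_ind (fun a => exists c', a = c' * F)); first by exists 0; rewrite mul0r.
  by move=> a b [c1 ->] [c2 ->]; exists (c1 + c2); rewrite mulrDl.
move=> i _; case: (eqVneq d (e - i)%N) => [<-|ne].
  by rewrite (pihomog_dE hF); eexists.
by exists 0; rewrite (pihomog_ne0 ne hF) mulr0 mul0r.
Qed.

(** For the lower bound, [F] restricted to the hyperplane is monic in [t] because [F.@[v] = 1], and
    the chain of primes above applies. For the upper bound, the ideal of the hyperplane is a nonzero
    prime contained in every point of the section, and [F] is not in it. *)
Lemma has_dim_hyperplane_section (k : finFieldType) m (F : {mpoly k[m.+3]}) d
    (w v : 'I_m.+3 -> k) :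
  F \is d.-homog -> (0 < d)%N -> F.@[v] = 1 ->
  (exists i, w i != 0) -> \sum_i w i * v i = 0 ->
  has_dim (scheme_inter (hypersurface F) (hypersurface (linform w))) m.
Proof.
move=> hF d0 Fv [i0 wi0] wv; split.
  pose P : 'rV[k]_(1 + (m.+1).+1) := \row_i v i.
  pose l : 'cV[k]_(1 + (m.+1).+1) := \col_i w i.
  have wl : linform w = linform (fun i => l i 0).
    by apply: eq_bigr => i _; rewrite mxE.
  have [|||U [uU U0 Ul]] := adapted_frame (P := P) (l := l).
  (* A form of positive degree vanishes at the origin, so [v] is not zero. *)
  - apply: contraTneq d0 => P0; rewrite lt0n negbK; apply: contraTT isT => dn0.
    have := oner_neq0 k; rewrite -Fv; case/eqP.
    rewrite mevalE big_seq big1 // => mm mF.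
    have [j mj] : exists j, mm j != 0%N.
      apply/existsP; apply: contraNT dn0 => /existsPn m0.
      rewrite -(homog_mdeg hF mF) mdegE sum_nat_eq0; apply/forallP=> j /=.
      by have := m0 j; rewrite negbK.
    have vj : v j = 0 by have := congr1 (fun A : 'rV_ _ => A 0 j) P0; rewrite !mxE.
    by rewrite (bigD1 j) //= vj expr0n (negPf mj) mul0r mulr0.
  - by apply: contraNneq wi0 => l0; have := congr1 (fun A : 'cV_ _ => A i0 0) l0; rewrite !mxE => ->.
  - apply/matrixP=> a b; rewrite [RHS]mxE -[RHS]wv mxE; apply: eq_bigr => i _.
    by rewrite !mxE mulrC.
  have UP i : U 0 i = v i by have := congr1 (fun A : 'rV_ _ => A 0 i) U0; rewrite !mxE.
  have phiX i : frame_morph U 'X_i = (v i)%:MP%:P * 'X + (frame_coef U i)%:P.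
    by rewrite frame_morphX UP.
  have [monF sF] := dhomog_top_monic (iota := @mpolyC m.+1 k) (phi := frame_morph U)
    (frame_morphC U) phiX hF Fv.
  apply: (exists_point_chain (phi := frame_morph U) monF); first by rewrite sF.
    move=> p e [_ [_ [[c ->] [c' ->] ->]]]; rewrite pihomogD.
    have [c1 ->] := pihomog_mulr_homog c e hF.
    have [c2 ->] := pihomog_mulr_homog c' e (linform_homog w).
    rewrite rmorphD !rmorphM /= wl frame_morph_linform Ul.
    have -> : (delta_mx (rshift 1 0) 0 : 'cV[k]_(1 + (m.+1).+1)) 0 0 = 0.
      by rewrite mxE -val_eqE.
    rewrite big1 => [|j _]; last by rewrite mxE -val_eqE /= scale0r.
    rewrite mpolyC0 !polyC0 mul0r add0r.
    by apply: dvdp_add; apply: dvdp_mull; rewrite ?dvdpp ?dvdp0.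
  (* This column of the inverse frame is the linear form that is 1 on the row of [U] belonging to
     [x_j] and 0 on the other rows. *)
  move=> j; exists (linform (fun i => invmx U i (rshift 1 (lift 0 j)))).
    exact: linform_homog.
  have -> : linform (fun i => invmx U i (rshift 1 (lift 0 j))) =
      linform (fun i => col (rshift 1 (lift 0 j)) (invmx U) i 0).
    by apply: eq_bigr => i _; rewrite mxE.
  apply: etrans (frame_morph_linform U (col (rshift 1 (lift 0 j)) (invmx U))) _.
  rewrite colE mulKVmx // mxE -val_eqE /= mpolyC0 polyC0 mul0r add0r.
  congr _%:P; rewrite (bigD1 j) //= mxE !eqxx scale1r big1 ?addr0 // => j' nj.
  by rewrite mxE (inj_eq (@rshift_inj _ _)) (inj_eq (@lift_inj _ _)) (negPf nj) scale0r.
move=> l C chC; pose e i := (w i0)^-1 *+ (i == i0).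
have we : \sum_i w i * e i = 1.
  rewrite (bigD1 i0) //= /e eqxx mulfV // big1 ?addr0 // => i /negPf->.
  by rewrite mulr0.
(* The ideal of the hyperplane, written as the kernel of the projection [hproj] so that its
   primality is immediate. *)
pose Q : {pred {mpoly k[m.+3]}} := fun p => hproj w e p == 0.
have QE p : (p \in Q) = (hproj w e p == 0) by [].
suff : (l.+3 <= m.+3)%N by rewrite !ltnS.
apply: (point_chain_length (Q := Q) (F := F) _ _ _ _ _ _ chC).
- split; rewrite ?QE ?rmorph0 ?rmorph1 ?oner_neq0 //.
  move=> a p p'; rewrite !QE => /eqP pQ /eqP pQ'.
  by rewrite rmorphD rmorphM /= pQ pQ' mulr0 addr0.
- by move=> p p'; rewrite !QE rmorphM mulf_eq0.
- rewrite QE; apply: contra_neqN (oner_neq0 k) => /eqP F0.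
  have := @morph_hproj k _ w e k (meval v) F; rewrite /= F0 meval_linform wv meval0 => /(_ erefl).
  by rewrite Fv => ->.
- by exists F, 0; split; [exists 1; rewrite mul1r | exists 0; rewrite mul0r | rewrite addr0].
- exists (linform w); first by rewrite QE hproj_linform.
  by apply: linform_neq0; exists i0.
move=> P [[idP _ _ _] sP] p; rewrite QE => /eqP p0.
have [c] := hproj_mod w e p; rewrite p0 subr0 => ->.
apply: idealrMl => //; apply: sP; exists 0, (linform w).
by split; [exists 0; rewrite mul0r | exists 1; rewrite mul1r | rewrite add0r].
Qed.

(** * Translation along a vector and derivatives *)

Lemma mpoly_deriv_eq n (R : nzRingType) (T : comNzRingType)
    (f : {rmorphism {mpoly R[n]} -> T}) (E E' : {mpoly R[n]} -> T) :
  (forall p q, E (p + q) = E p + E q) -> (forall p q, E' (p + q) = E' p + E' q) ->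
  (forall p q, E (p * q) = E p * f q + f p * E q) ->
  (forall p q, E' (p * q) = E' p * f q + f p * E' q) ->
  (forall c, E c%:MP = E' c%:MP) -> (forall i, E 'X_i = E' 'X_i) -> E =1 E'.
Proof.
move=> ED ED' EM EM' EC EX p.
have E0 : E 0 = E' 0 by rewrite -(mpolyC0 n R) EC.
have E1 : E 1 = E' 1 by rewrite -(mpolyC1 n R) EC.
rewrite (mpolyE p); elim/big_ind: _ => // [a b Ea Eb|m _]; first by rewrite ED ED' Ea Eb.
rewrite -mul_mpolyC EM EM' EC; congr (_ + _ * _).
rewrite mpolyXE_id; elim/big_ind: _ => // [a b Ea Eb|i _]; first by rewrite EM EM' Ea Eb.
by elim: (m i) => [|e IHe]; rewrite ?expr0 // exprS EM EM' EX IHe.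
Qed.

Lemma poly_morph_eq (R : nzRingType) (T : comNzRingType)
    (f g : {rmorphism {poly R} -> T}) :
  (forall c, f c%:P = g c%:P) -> f 'X = g 'X -> f =1 g.
Proof.
move=> fC fX p; rewrite -[p]coefK poly_def !rmorph_sum; apply: eq_bigr => i _.
by rewrite -mul_polyC !rmorphM !rmorphXn fC fX.
Qed.

(** Exact divisibility, as opposed to [%|], which allows a scalar factor. *)
Definition divisible (R : comNzRingType) (F a : R) : Prop := exists c, a = c * F.

Section Divisible.
Variables (R : comNzRingType) (F : R).

Lemma divisible0 : divisible F 0. Proof. by exists 0; rewrite mul0r. Qed.

Lemma divisibleD a b : divisible F a -> divisible F b -> divisible F (a + b).
Proof. by move=> [c ->] [c' ->]; exists (c + c'); rewrite mulrDl. Qed.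

Lemma divisibleMl a b : divisible F b -> divisible F (a * b).
Proof. by move=> [c ->]; exists (a * c); rewrite mulrA. Qed.

Lemma divisible_sum (I : Type) (r : seq I) (P : pred I) (G : I -> R) :
  (forall i, P i -> divisible F (G i)) -> divisible F (\sum_(i <- r | P i) G i).
Proof.
by move=> FG; apply: (big_ind (divisible F)) => //; [exact: divisible0|exact: divisibleD].
Qed.

(* If [i] is minimal with [g_i] not divisible by [F], the coefficient of index [2 i] of [g ^ 2] is [g_i ^ 2] modulo [F]. *)
Lemma radical_coef (g h : {poly R}) :
  (forall i, divisible F (g`_i ^+ 2) -> divisible F g`_i) ->
  g * g = h * F%:P -> forall i, divisible F g`_i.
Proof.
move=> radF gg i; have [n] := ubnP i; elim: n i => // n IHn i; rewrite ltnS => le_in.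
apply: radF; have le_i : (i < (i + i).+1)%N by rewrite ltnS leq_addr.
have : divisible F (g * g)`_(i + i) by rewrite gg coefMC; exists h`_(i + i).
rewrite coefM (bigD1 (Ordinal le_i)) //= addKn => ggF.
rewrite expr2 -[g`_i * g`_i](addrK (\sum_(j < (i + i).+1 | j != Ordinal le_i) g`_j * g`_(i + i - j))).
apply: divisibleD => //; rewrite -mulN1r; apply: divisibleMl; apply: divisible_sum => j.
rewrite -val_eqE /=; case: ltngtP => // [ji|ij] _.
  by rewrite mulrC; apply: divisibleMl; apply: IHn; apply: leq_trans ji le_in.
apply: divisibleMl; apply: IHn; apply: leq_trans le_in.
by rewrite ltn_subLR ?ltn_add2r // -ltnS.
Qed.

End Divisible.

Section Shift.
Variables (R : comNzRingType) (n : nat) (v : 'I_n -> R).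

(* [p |-> p (x + t v)] *)
Definition shift : {mpoly R[n]} -> {poly {mpoly R[n]}} :=
  mmap (polyC \o @mpolyC n R) (fun i => (v i)%:MP%:P * 'X + ('X_i)%:P).
HB.instance Definition _ := GRing.RMorphism.on shift.

Lemma shiftC c : shift c%:MP = c%:MP%:P. Proof. exact: mmapC. Qed.

Lemma shiftX i : shift 'X_i = (v i)%:MP%:P * 'X + ('X_i)%:P.
Proof. by rewrite /shift mmapX mmap1U. Qed.

(** Setting [t = 0] turns an exact divisibility by [shift v F] into one by [F]. *)
Lemma shift_horner0 p : (shift p).[0] = p.
Proof.
apply: (mpoly_morph_eq (f := horner_eval 0 \o shift) (g := idfun)) => [c|i] /=.
  by rewrite shiftC /horner_eval hornerC.
by rewrite shiftX /horner_eval !hornerE.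
Qed.

Lemma shift_monic F d : F \is d.-homog -> F.@[v] = 1 ->
  shift F \is monic /\ size (shift F) = d.+1.
Proof.
exact: (dhomog_top_monic (iota := @mpolyC n R) (phi := shift) shiftC shiftX).
Qed.

Lemma map_mderiv_mul i (p q : {poly {mpoly R[n]}}) :
  map_poly (mderiv i) (p * q) = map_poly (mderiv i) p * q + p * map_poly (mderiv i) q.
Proof.
apply/polyP=> j; rewrite coefD coef_map !coefM raddf_sum -big_split /=.
by apply: eq_bigr => l _; rewrite !coef_map mderivM.
Qed.

Lemma map_mderiv_shift i p : map_poly (mderiv i) (shift p) = shift p^`M(i).
Proof.
apply: (mpoly_deriv_eq (f := shift) (E := fun p => map_poly (mderiv i) (shift p))
  (E' := fun p => shift p^`M(i))) => [a b|a b|a b|a b|c|j].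
- by rewrite !rmorphD raddfD.
- by rewrite mderivD rmorphD.
- by rewrite rmorphM map_mderiv_mul.
- by rewrite mderivM rmorphD !rmorphM.
- by rewrite shiftC map_polyC /= !mderivC !rmorph0.
apply/polyP=> l; rewrite shiftX coef_map /= coefD coefCM coefX coefC mderivD.
rewrite mderiv_mulC (_ : (l == 1%N)%:R = ((l == 1%N)%:R)%:MP); last by rewrite mpolyC_nat.
rewrite mderivC mulr0 add0r; have Xij : ('X_j)^`M(i) = ((j == i)%:R)%:MP :> {mpoly R[n]}.
  rewrite mderivX mnm1E; case: (eqVneq j i) => [->|_]; last by rewrite scale0r mpolyC0.
  by rewrite (_ : (U_(i) - U_(i))%MM = 0%MM) ?mpolyX0 ?scale1r //; apply/mnmP=> a; rewrite mnmBE subnn mnm0E.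
by rewrite Xij shiftC coefC; case: (l == 0%N); rewrite ?mderiv0.
Qed.

Lemma deriv_shift p : (shift p)^`() = \sum_i (v i)%:MP%:P * shift p^`M(i).
Proof.
apply: (mpoly_deriv_eq (f := shift) (E := fun p => (shift p)^`())
  (E' := fun p => \sum_i (v i)%:MP%:P * shift p^`M(i))) => [a b|a b|a b|a b|c|j].
- by rewrite rmorphD derivD.
- by rewrite -big_split /=; apply: eq_bigr => i _; rewrite mderivD rmorphD mulrDr.
- by rewrite rmorphM derivM.
- rewrite mulr_suml mulr_sumr -big_split /=; apply: eq_bigr => i _.
  by rewrite mderivM rmorphD !rmorphM /= mulrDr; congr (_ + _); [exact: mulrA|exact: mulrCA].
- rewrite shiftC derivC big1 // => i _; by rewrite mderivC rmorph0 mulr0.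
rewrite shiftX derivD derivC addr0 derivM derivC mul0r add0r derivX mulr1.
rewrite (bigD1 j) //= big1 ?addr0 => [|i ij]; last first.
  by rewrite mderivX mnm1E eq_sym (negPf ij) scale0r rmorph0 mulr0.
rewrite mderivX mnm1E eqxx scale1r (_ : (U_(j) - U_(j))%MM = 0%MM) ?mpolyX0 ?rmorph1 ?mulr1 //.
by apply/mnmP=> a; rewrite mnmBE subnn mnm0E.
Qed.

Lemma shift_linform w : \sum_i w i * v i = 0 -> shift (linform w) = (linform w)%:P.
Proof.
move=> wv; rewrite morph_linform.
have E i : shift (w i)%:MP * shift 'X_i = (w i * v i)%:MP%:P * 'X + (w i *: 'X_i)%:P.
  by rewrite shiftC shiftX mulrDr mulrA -!polyCM -mpolyCM mul_mpolyC.
under eq_bigr => i _ do rewrite /= E.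
rewrite big_split /= -mulr_suml -!rmorph_sum /= wv.
by rewrite mpolyC0 polyC0 mul0r add0r.
Qed.

End Shift.

Section DirectionalDerivative.
Variables (R : comNzRingType) (n : nat) (u : 'I_n -> R).

Definition dirder (p : {mpoly R[n]}) : {mpoly R[n]} := \sum_i u i *: p^`M(i).

Definition dirder_poly (p : {poly {mpoly R[n]}}) : {poly {mpoly R[n]}} :=
  \sum_i (u i)%:MP%:P * map_poly (mderiv i) p.

Lemma dirder_polyM p q : dirder_poly (p * q) = dirder_poly p * q + p * dirder_poly q.
Proof.
rewrite mulr_suml mulr_sumr -big_split /=; apply: eq_bigr => i _.
by rewrite map_mderiv_mul mulrDr; congr (_ + _); [exact: mulrA|exact: mulrCA].
Qed.

Lemma dirder_poly_shift v p : dirder_poly (shift v p) = shift v (dirder p).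
Proof.
rewrite rmorph_sum; apply: eq_bigr => i _ /=.
by rewrite map_mderiv_shift -mul_mpolyC rmorphM /= shiftC.
Qed.

(** In the direction of the translation itself the derivative is d/dt; hence [v] is a good direction
    as soon as [shift v F] is separable in [t]. *)
Lemma deriv_shift_dirder p : (shift u p)^`() = shift u (dirder p).
Proof.
rewrite deriv_shift rmorph_sum; apply: eq_bigr => i _ /=.
by rewrite -mul_mpolyC rmorphM /= shiftC.
Qed.

End DirectionalDerivative.

Lemma monic_dvdpP (R : idomainType) (f g : {poly R}) :
  f \is monic -> reflect (exists q, g = q * f) (f %| g).
Proof. by move=> monf; apply: (Pdiv.IdomainMonic.dvdpP monf). Qed.

(* Smoothness of the binary form cut out by a single line, even a line over an extension, makes the
   hypersurface generically smooth along every component. *)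
Lemma coprimep_radical (k : idomainType) n (T : idomainType)
    (h : {rmorphism {mpoly k[n]} -> T}) (F : {mpoly k[n]}) d (u v : 'I_n -> k) :
  F \is d.-homog -> (0 < d)%N -> F.@[v] = 1 ->
  coprimep (map_poly h (shift v F)) (map_poly h (shift v (dirder u F))) ->
  forall g e, divisible F (g ^+ e) -> divisible F g.
Proof.
move=> hF d0 Fv cop g e [c gE].
have [monF sF] := shift_monic hF Fv.
have {cop} cop : coprimep (shift v F) (dirder_poly u (shift v F)).
  by rewrite dirder_poly_shift; apply: coprimep_specialize cop; rewrite ?sF.
have sqf := coprimep_deriv_sqfree (dirder_polyM u) cop.
have : shift v F %| shift v g ^+ e.
  apply/monic_dvdpP => //; exists (shift v c).
  by rewrite -rmorphXn gE rmorphM.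
move/(sqfree_dvdpX (monic_neq0 monF) sqf)/(monic_dvdpP _ monF) => [q gq].
by exists q.[0]; rewrite -(shift_horner0 v g) gq hornerM shift_horner0.
Qed.

(** * From reducedness to squarefreeness *)

Lemma divisible_polyC (R : comNzRingType) (F : R) (p : {poly R}) :
  (forall i, divisible F p`_i) -> divisible F%:P p.
Proof.
move=> Fp; rewrite -[p]coefK poly_def; apply: divisible_sum => i _.
have [c ->] := Fp i; exists (c *: 'X^i).
by rewrite [RHS]mulrC mul_polyC scalerA mulrC.
Qed.

Section Unshift.
Variables (R : comNzRingType) (n : nat).
Local Notation S := {mpoly R[n]}.

(** The automorphism of [S[t]] that sends [x] to [x + t v] and fixes [t]. Its inverse brings
    [shift v F] back to the constant polynomial [F%:P]. *)
Definition tshift (v : 'I_n -> R) : {poly S} -> {poly S} :=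
  horner_eval 'X \o map_poly (shift v).
HB.instance Definition _ v := GRing.RMorphism.on (tshift v).

Lemma tshiftC v p : tshift v p%:P = shift v p.
Proof. by rewrite /tshift /= map_polyC /horner_eval hornerC. Qed.

Lemma tshiftX v : tshift v 'X = 'X.
Proof. by rewrite /tshift /= map_polyX /horner_eval hornerX. Qed.

Lemma tshiftK v w : (forall i, w i + v i = 0) -> cancel (tshift w) (tshift v).
Proof.
move=> wv p; apply: (poly_morph_eq (f := tshift v \o tshift w) (g := idfun)) => [c|] /=.
  rewrite tshiftC; apply: (mpoly_morph_eq (f := tshift v \o shift w) (g := @polyC _)) => [a|i] /=.
    by rewrite shiftC tshiftC shiftC.
  rewrite shiftX rmorphD rmorphM /= !tshiftC tshiftX shiftC shiftX addrA -mulrDl.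
  by rewrite -polyCD -mpolyCD wv mpolyC0 polyC0 mul0r add0r.
by rewrite !tshiftX.
Qed.

End Unshift.

(** If [a *: shift v F = H * (B * B)], then [shift v F] divides the square of [H * B]. After undoing
    the translation, [radical_coef] shows that it divides [H * B] itself, so that [B] divides the
    scalar [a]. *)
Lemma radical_sqfree (k : idomainType) n (F : {mpoly k[n]}) d (v : 'I_n -> k) :
  F \is d.-homog -> F.@[v] = 1 ->
  (forall g, divisible F (g ^+ 2) -> divisible F g) ->
  sqfree (shift v F).
Proof.
move=> hF Fv radF B /Pdiv.Idomain.dvdpP[[a H] /= a0 e].
have [monF sF] := shift_monic hF Fv; have F0 := monic_neq0 monF.
pose nv i := - v i.
have nvK : cancel (tshift nv) (tshift v) by apply: tshiftK => i; rewrite addNr.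
have vK : cancel (tshift v) (tshift nv) by apply: tshiftK => i; rewrite addrN.
have gg0 : (H * B) * (H * B) = (a%:P * H) * shift v F.
  by rewrite -mulrA (mulrCA B H B) -e -mul_polyC mulrA [H * _]mulrC.
have gg : tshift nv (H * B) * tshift nv (H * B) = tshift nv (a%:P * H) * F%:P.
  rewrite -(vK F%:P) tshiftC -[RHS]rmorphM -gg0.
  exact: (esym (rmorphM (tshift nv) _ _)).
have [q gE] : divisible F%:P (tshift nv (H * B)).
  by apply: divisible_polyC => j; apply: radical_coef gg j => l; apply: radF.
have gF : H * B = tshift v q * shift v F.
  by rewrite -[LHS]nvK gE rmorphM /= tshiftC.
have /eqP : a%:P = tshift v q * B.
  apply: (mulIf F0); rewrite mul_polyC e mulrA gF -!mulrA; congr (_ * _).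
  exact: mulrC.
move/eqP/(congr1 (fun p : {poly _} => size p)); rewrite size_polyC a0 => /esym sB.
have B0 : B != 0 by apply: contra_eq_neq sB => ->; rewrite mulr0 size_poly0.
have q0 : tshift v q != 0 by apply: contra_eq_neq sB => ->; rewrite mul0r size_poly0.
move: sB; rewrite size_mul // -size_poly_eq1.
move: B0 q0; rewrite -!size_poly_gt0; case: (size B) => [//|[//|b]] _.
by case: (size (tshift v q)) => // s _; rewrite !addnS.
Qed.

(** Reducedness is applied on the chart where the linear form [w] is invertible. Since [w] vanishes
    at [v], it does not involve [t] after translation, and its powers cancel against the monic
    [shift v F]. General [g] are treated through their homogeneous components. *)
Lemma reduced_radical (k : fieldType) n (F w : {mpoly k[n.+1]}) d (v : 'I_n.+1 -> k) :
  F \is d.-homog -> F.@[v] = 1 ->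
  w != 0 -> w \is 1.-homog -> shift v w = w%:P ->
  reduced (hypersurface F) ->
  forall g, divisible F (g ^+ 2) -> divisible F g.
Proof.
move=> hF Fv w0 hw sw redF.
have [monF sF] := shift_monic hF Fv.
have radh e a : a \is e.-homog -> divisible F (a ^+ 2) -> divisible F a.
  move=> ha [c ca]; have [||N] := redF 1%N e 2%N w a isT hw.
  - by rewrite muln1.
  - by exists 0%N, c; rewrite expr0 mul1r.
  case=> c' cE; have : shift v F %| (w ^+ N) *: shift v a.
    apply/monic_dvdpP => //; exists (shift v c').
    by rewrite -rmorphM -cE rmorphM rmorphXn /= sw -mul_polyC rmorphXn.
  rewrite dvdpZr ?expf_neq0 // => /(monic_dvdpP _ monF)[q aq].
  by exists q.[0]; rewrite -(shift_horner0 v a) aq hornerM shift_horner0.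
have gradeF : grade F = F%:P * 'X^d.
  apply/polyP=> e; rewrite coef_grade coefCM coefXn.
  case: eqP => [->|/eqP ne]; first by rewrite mulr1 (pihomog_dE hF).
  by rewrite mulr0 (pihomog_ne0 _ hF) // eq_sym.
move=> g [c gF]; have gg : grade g * grade g = (grade c * 'X^d) * F%:P.
  have gM (a b : {mpoly k[n.+1]}) : grade (a * b) = grade a * grade b by apply: rmorphM.
  rewrite expr2 in gF; refine (etrans (esym (gM g g)) _); rewrite gF gM gradeF.
  by move: (grade c) => C; rewrite -mulrA; congr (_ * _); apply: mulrC.
have dvd e : divisible F (pihomog mdeg e g).
  rewrite -coef_grade; apply: radical_coef gg e => e.
  rewrite coef_grade; apply: radh; exact: pihomogP.
rewrite (pihomog_partitionE (mf := mdeg) (leqnn (msize g))).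
by apply: divisible_sum => e _; apply: dvd.
Qed.

(** * Derivatives over a perfect field *)

Lemma finField_pth_root (k : finFieldType) p (c : k) : p \in [pchar k] ->
  exists b, b ^+ p = c.
Proof.
move=> pk; have inj : injective (pFrobenius_aut pk) by apply: fmorph_inj.
by exists (invF inj c); rewrite -(pFrobenius_autE pk) f_invF.
Qed.

Section PthPower.
Variables (R : comNzRingType) (p : nat).
Hypothesis pR : p \in [pchar R].

Lemma pth_power_sum (I : eqType) (r : seq I) (G : I -> R) :
  (forall i, i \in r -> exists b, b ^+ p = G i) -> exists b, b ^+ p = \sum_(i <- r) G i.
Proof.
have pp := pcharf_prime pR.
elim: r => [|i r IHr] Gp; first by exists 0; rewrite big_nil expr0n eqn0Ngt prime_gt0.
have [|b bE] := IHr; first by move=> j jr; apply: Gp; rewrite inE jr orbT.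
have [c cE] := Gp i (mem_head _ _).
exists (c + b); rewrite big_cons -cE -bE exprDn_pchar //.
by apply/pnatP; rewrite ?prime_gt0 // => q qp; rewrite dvdn_prime2 // => /eqP->.
Qed.

End PthPower.

(** Vanishing derivatives make all exponents divisible by [p], and Frobenius is onto on the
    coefficients. *)
Lemma mpoly_pth_root (k : finFieldType) n p (q : {mpoly k[n]}) : p \in [pchar k] ->
  (forall i, q^`M(i) = 0) -> exists r, r ^+ p = q.
Proof.
move=> pk dq; rewrite (mpolyE q); apply: pth_power_sum.
  exact: (rmorph_pchar (@mpolyC n k)).
move=> m mq; have [b bE] := finField_pth_root q@_m pk.
exists (b *: 'X_[[multinom (m i %/ p)%N | i < n]]).
rewrite exprZn bE mpolyXn; congr (_ *: 'X_[_]); apply/mnmP=> i.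
rewrite mulmnE mnmE divnK //; case: (posnP (m i)) => [->|mi]; first exact: dvdn0.
rewrite (dvdn_pcharf pk); have := congr1 (mcoeff (m - U_(i))) (dq i).
rewrite mcoeff_deriv mcoeff0 mnmBE mnm1E eqxx subn1 prednK // submK; last first.
  by rewrite lep1mP -lt0n.
have q0 : q@_m != 0 by rewrite -mcoeff_msupp.
by move/eqP; rewrite -[q@_m *+ _]mulr_natr mulf_eq0 (negPf q0).
Qed.

Lemma mderiv_exp n (R : comNzRingType) i (c : {mpoly R[n]}) e :
  (c ^+ e)^`M(i) = c ^+ e.-1 * c^`M(i) *+ e.
Proof.
elim: e => [|e IHe]; first by rewrite expr0 -mpolyC1 mderivC mulr0n.
rewrite exprS mderivM IHe /= mulrS mulrC; congr (_ + _).
by case: e {IHe} => [|e]; rewrite ?mulr0n ?mulr0 // mulrnAr mulrA -exprS.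
Qed.

Lemma poly_pth_root (k : finFieldType) n p (g : {poly {mpoly k[n]}}) : p \in [pchar k] ->
  (forall i, map_poly (mderiv i) g = 0) -> g^`() = 0 -> exists r, r ^+ p = g.
Proof.
move=> pk dg g'; rewrite -[g]coefK poly_def.
have pR : p \in [pchar {mpoly k[n]}] by apply: (rmorph_pchar (@mpolyC n k)).
have pP : p \in [pchar {poly {mpoly k[n]}}].
  exact: (rmorph_pchar (@polyC {mpoly k[n]})).
rewrite -(big_mkord xpredT (fun i => g`_i *: 'X^i)).
apply: (pth_power_sum pP) => j _.
case: (eqVneq g`_j 0) => [->|gj].
  by exists 0; rewrite scale0r expr0n eqn0Ngt prime_gt0 ?(pcharf_prime pk).
have [i|b bE] := mpoly_pth_root (q := g`_j) pk.
  by have := congr1 (coefp j) (dg i); rewrite /= coef_map coef0.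
have pj : (p %| j)%N.
  rewrite (dvdn_pcharf pR); case: j gj {b bE} => [|j] gj; first by rewrite mulr0n.
  have := congr1 (coefp j) g'; rewrite /= coef_deriv coef0 -[g`_j.+1 *+ _]mulr_natr => /eqP.
  by rewrite mulf_eq0 (negPf gj).
by exists (b *: 'X^(j %/ p)); rewrite exprZn bE -exprM divnK.
Qed.

(* Over a perfect field, a factor of a squarefree polynomial does not divide all its partial derivatives:
   otherwise, suitably scaled, it would have vanishing derivatives and be a [p]-th power. *)
Lemma sqfree_perfect (k : finFieldType) n (f g : {poly {mpoly k[n]}}) :
  sqfree f -> irreducible_poly g -> g %| f -> g %| f^`() ->
  exists i, ~~ (g %| map_poly (mderiv i) f).
Proof.
move=> sqf irr gf gf'; apply: NNPP => nex.
have gdf i : g %| map_poly (mderiv i) f.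
  by apply/negPn/negP => nd; apply: nex; exists i.
have [p pp pk] := finPcharP k; have g0 := irreducible_neq0 irr.
have pR : p \in [pchar {mpoly k[n]}] by apply: (rmorph_pchar (@mpolyC n k)).
have lc0 : lead_coef g != 0 by rewrite lead_coef_eq0.
have g'0 : g^`() = 0.
  have := sqfree_dvdp_deriv (fun a b => derivM a b) sqf irr gf gf'.
  by apply: contraTeq => g'0; rewrite gtNdvdp // lt_size_deriv.
(* The derivative of [g] is divisible by [g] and has no larger degree in [t], so it is proportional
   to [g]; the ratio is read off the leading coefficients. *)
have lcg i : (lead_coef g) *: map_poly (mderiv i) g = (lead_coef g)^`M(i) *: g.
  have := sqfree_dvdp_deriv (map_mderiv_mul i) sqf irr gf (gdf i).
  set h := map_poly _ g => gh; have sh : (size h <= size g)%N by apply: size_poly.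
  have lch : (lead_coef g)^`M(i) = h`_(size g).-1 by rewrite coef_map.
  case: (eqVneq h 0) => [h0|h0]; first by rewrite lch h0 coef0 scaler0 scale0r.
  have /eqpP[[a b] /= /andP[a0 b0] hg] : g %= h.
    by rewrite -dvdp_size_eqp // eqn_leq sh andbT dvdp_leq.
  have := congr1 (fun q : {poly _} => q`_(size g).-1) hg; rewrite !coefZ -lch -lead_coefE => e.
  suff : b%:P * (lead_coef g *: h) = b%:P * ((lead_coef g)^`M(i) *: g).
    by apply: mulfI; rewrite polyC_eq0.
  rewrite !mul_polyC scalerA mulrC -scalerA -hg !scalerA -e.
  by congr (_ *: _); apply: mulrC.
(* With [c g' = c' g], the product rule applied to [c g1 = c ^ p g] gives [c g1' = 0], because the
   derivative of [c ^ p] is zero. *)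
pose c := lead_coef g; pose g1 := c ^+ p.-1 *: g.
have dg1 i : map_poly (mderiv i) g1 = 0.
  have cg : c%:P * g1 = (c ^+ p)%:P * g.
    by rewrite !mul_polyC scalerA -exprS prednK // prime_gt0.
  have := congr1 (map_poly (mderiv i)) cg.
  rewrite !map_mderiv_mul !map_polyC /= mderiv_exp.
  have -> : c ^+ p.-1 * c^`M(i) *+ p = 0.
    by rewrite -mulr_natr (_ : p%:R = 0) ?mulr0 //; apply: (pcharf0 pR).
  rewrite polyC0 mul0r add0r => e.
  have {e} : c%:P * map_poly (mderiv i) g1 = 0.
    apply: (addrI ((c^`M(i))%:P * g1)); rewrite e addr0 /g1 !mul_polyC.
    rewrite -[in LHS](prednK (prime_gt0 pp)) exprSr -scalerA lcg.
    by rewrite !scalerA mulrC.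
  by move/eqP; rewrite mulf_eq0 polyC_eq0 (negPf lc0) => /eqP.
have [|r rE] := poly_pth_root pk dg1; first by rewrite derivZ g'0 scaler0.
have cp0 : c ^+ p.-1 != 0 by rewrite expf_neq0.
(* Now [g] divides [r], while the degree of [g] is [p] times that of [r], which is absurd. *)
have g_r : g %| r.
  apply: (irreducible_dvdpX (n := p)) => //.
  by rewrite rE dvdpZr.
have r0 : r != 0.
  apply: contraNneq g0 => r0; have /eqP := rE; rewrite r0 expr0n eqn0Ngt prime_gt0 //= eq_sym.
  by rewrite /g1 -mul_polyC mulf_eq0 polyC_eq0 (negPf cp0).
have := congr1 (fun q : {poly _} => (size q).-1) rE; rewrite size_exp size_scale // => sE.
have := dvdp_leq r0 g_r; case: irr => + _.
rewrite -[size g]prednK ?size_poly_gt0 // -[size r]prednK ?size_poly_gt0 // -sE !ltnS.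
rewrite muln_gt0 => /andP[sr _]; rewrite leqNgt => /negP[].
by rewrite ltn_Pmulr // prime_gt1.
Qed.

(** * Change of base point *)

Section NonZeroDivisor.
Variables (k : idomainType) (n : nat) (F D : {mpoly k[n]}) (d : nat) (v : 'I_n -> k).
Hypotheses (hF : F \is d.-homog) (Fv : F.@[v] = 1).

(** [D] is not a zero divisor modulo [F]. This does not refer to the base point [v], and so carries
    coprimality from one base point to another. *)
Definition coprime_mod := forall h, divisible F (h * D) -> divisible F h.

Lemma coprimep_shift_mod : coprimep (shift v F) (shift v D) -> coprime_mod.
Proof.
have [monF sF] := shift_monic hF Fv.
move=> cop h [c hD]; have : shift v F %| shift v h * shift v D.
  apply/monic_dvdpP => //; exists (shift v c).
  have e : shift v (h * D) = shift v h * shift v D by apply: rmorphM.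
  refine (etrans (esym e) _); rewrite hD; exact: rmorphM.
rewrite Pdiv.Idomain.Gauss_dvdpl // => /(monic_dvdpP _ monF)[q hq].
by exists q.[0]; rewrite -(shift_horner0 v h) hq hornerM shift_horner0.
Qed.

Lemma coprime_mod_polyC (X Y : {poly {mpoly k[n]}}) :
  coprime_mod -> X * D%:P = Y * F%:P -> divisible F%:P X.
Proof.
move=> nzd E; apply: divisible_polyC => i; apply: nzd; exists Y`_i.
by rewrite -coefMC E coefMC.
Qed.

(** A common factor [g], with cofactors [H] of [shift v F] and [M] of [shift v D], gives
    [b H * shift v D = a M * shift v F]. Undoing the translation, the hypothesis shows that
    [shift v F] divides [b H], so [g] has degree 0. *)
Lemma mod_coprimep_shift : coprime_mod -> coprimep (shift v F) (shift v D).
Proof.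
have [monF sF] := shift_monic hF Fv; have F0 := monic_neq0 monF.
move=> nzd; apply/Pdiv.Idomain.coprimepP => g.
move=> /Pdiv.Idomain.dvdpP[[a H] /= a0 e] /Pdiv.Idomain.dvdpP[[b M] /= b0 e'].
pose nv i := - v i.
have nvK : cancel (tshift nv) (tshift v) by apply: tshiftK => i; rewrite addNr.
have vK : cancel (tshift v) (tshift nv) by apply: tshiftK => i; rewrite addrN.
have tM w p q : tshift w (p * q) = tshift w p * tshift w q :> {poly {mpoly k[n]}} by apply: rmorphM.
have E : (b%:P * H) * shift v D = (a%:P * M) * shift v F.
  rewrite [b%:P * H]mulrC [a%:P * M]mulrC -[LHS]mulrA -[RHS]mulrA !mul_polyC e e'.
  exact: mulrCA.
have {}E : tshift nv (b%:P * H) * D%:P = tshift nv (a%:P * M) * F%:P.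
  rewrite -(vK D%:P) -(vK F%:P) !tshiftC.
  refine (etrans (esym (tM _ _ _)) (etrans _ (tM _ _ _))).
  by rewrite E.
have [q qE] := coprime_mod_polyC nzd E.
have bH : b *: H = tshift v q * shift v F.
  rewrite -mul_polyC -[LHS]nvK qE -(tshiftC v F); exact: tM.
have H0 : H != 0.
  apply: contraNneq F0 => H0; have /eqP := e; rewrite H0 mul0r.
  by rewrite -mul_polyC mulf_eq0 polyC_eq0 (negPf a0).
have : (size (shift v F) <= size H)%N.
  rewrite -(size_scale _ b0); apply: dvdp_leq; first by rewrite -mul_polyC mulf_neq0 ?polyC_eq0.
  by rewrite bH dvdp_mull.
have g0 : g != 0.
  apply: contraNneq F0 => g0; have /eqP := e; rewrite g0 mulr0.
  by rewrite -mul_polyC mulf_eq0 polyC_eq0 (negPf a0).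
rewrite -(size_scale (shift v F) a0) e size_mul // -size_poly_eq1.
move: H0 g0; rewrite -!size_poly_gt0; case: (size H) => // h _; case: (size g) => // [[|m]] // _.
by rewrite !addnS /= addSn ltnNge leq_addr.
Qed.

End NonZeroDivisor.

(** * Choice of a direction *)

(** The remainder modulo [g] of a combination of the [p j] is linear in [u]; a coefficient at which
    it is not identically zero gives the form [l]. *)
Lemma linear_ndvdp (S : idomainType) N (p : 'I_N -> {poly S}) (g : {poly S}) :
  g != 0 -> (exists j, ~~ (g %| p j)) ->
  exists2 l : 'I_N -> S, (exists j, l j != 0)
    & forall u : 'I_N -> S, \sum_j l j * u j != 0 -> ~~ (g %| \sum_j (u j)%:P * p j).
Proof.
move=> g0 [j0 nd].
(* Pseudo-division scales each [p j] by its own [a j]; the product [A] is a common scaling that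
   restores linearity. *)
pose a j := lead_coef g ^+ scalp (p j) g.
have a0 j : a j != 0 by rewrite expf_neq0 // lead_coef_eq0.
pose A := \prod_j a j.
pose r j := (\prod_(i | i != j) a i) *: (p j %% g).
have rE j : g %| A *: p j - r j.
  rewrite /A (bigD1 j) //= mulrC -scalerA Pdiv.Idomain.divp_eq /r scalerDr.
  by rewrite addrK -mul_polyC mulrA dvdp_mull.
have [l rl] : exists l, (r j0)`_l != 0.
  exists (size (r j0)).-1; rewrite -lead_coefE lead_coef_eq0 /r -mul_polyC mulf_neq0 //.
  by rewrite polyC_eq0; apply/prodf_neq0 => i _; apply: a0.
exists (fun j => (r j)`_l); first by exists j0.
move=> u; apply: contra => gu.
have : g %| \sum_j (u j)%:P * r j.
  have -> : \sum_j (u j)%:P * r j = A *: (\sum_j (u j)%:P * p j) - \sum_j (u j)%:P * (A *: p j - r j).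
    rewrite scaler_sumr -sumrB; apply: eq_bigr => j _.
    have e : (u j)%:P * (A *: p j) = A *: ((u j)%:P * p j) by rewrite scalerAr.
    by rewrite mulrBr e opprB addrCA subrr addr0.
  apply: dvdp_sub; first by rewrite dvdpZr //; apply/prodf_neq0 => i _; apply: a0.
  by apply: (big_ind (fun x => g %| x)); [exact: dvdp0 | exact: dvdp_add | move=> j _; apply: dvdp_mull].
have sr : (size (\sum_j (u j)%:P * r j)%R < size g)%N.
  apply: leq_ltn_trans (size_sum _ _ _) _.
  rewrite big_tnth; elim/big_ind: _ => [|x y xg yg|j _].
  - by rewrite size_poly_gt0.
  - by rewrite gtn_max xg.
  rewrite mul_polyC; apply: leq_ltn_trans (size_scale_leq _ _) _.
  apply: leq_ltn_trans (size_scale_leq _ _) _; by rewrite ltn_modp.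
case: (eqVneq (\sum_j (u j)%:P * r j) 0) => [e _|nz]; last by rewrite gtNdvdp.
apply/eqP; have := congr1 (fun x : {poly S} => x`_l) e; rewrite coef_sum coef0 => e0; rewrite -[RHS]e0.
by apply: eq_bigr => j _; rewrite coefCM mulrC.
Qed.

(** [P] is the product of one linear form for each factor in [s]. *)
Lemma direction_form (S : idomainType) N (p : 'I_N -> {poly S}) (s : seq {poly S}) :
  (forall g, g \in s -> g != 0 /\ exists j, ~~ (g %| p j)) ->
  exists P : {mpoly S[N]}, [/\ P != 0, P \is (size s).-homog
    & forall u, P.@[u] != 0 -> forall g, g \in s -> ~~ (g %| \sum_j (u j)%:P * p j)].
Proof.
elim: s => [|g s IHs] sP.
  by exists 1; split; rewrite ?oner_neq0 //; exact: dhomog1.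
have [|P [P0 hP uP]] := IHs; first by move=> h hs; apply: sP; rewrite inE hs orbT.
have [g0 gj] := sP g (mem_head _ _); have [l l0 lu] := linear_ndvdp g0 gj.
exists (linform l * P); split.
- by rewrite mulf_neq0 // linform_neq0.
- by rewrite /= -add1n; apply: dhomogM hP; apply: linform_homog.
move=> u; rewrite mevalM mulf_eq0 negb_or => /andP[lu0 Pu] h; rewrite inE => /predU1P[->|]; last exact: uP.
by apply: lu; rewrite -meval_linform.
Qed.

Lemma dhomog_rational_point (k : finFieldType) (S : idomainType)
    (iota : {rmorphism k -> S}) n (P : {mpoly S[n]}) e :
  P != 0 -> P \is e.-homog -> (e <= #|k|)%N ->
  exists c : 'I_n -> k, P.@[fun i => iota (c i)] != 0.
Proof.
move=> P0 hP ek; pose s := [seq iota c | c <- enum k].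
have [|||| v vs Pv] := @dhomog_grid_neq0 S n s P e _ _ _ P0 hP.
- by rewrite map_inj_uniq ?enum_uniq //; apply: fmorph_inj.
- by apply/mapP; exists 0; rewrite ?mem_enum ?rmorph0.
- by apply/mapP; exists 1; rewrite ?mem_enum ?rmorph1.
- by rewrite size_map -cardE.
have ex i : exists c, iota c == v i.
  by have /mapP[c _ ->] := vs i; exists c.
exists (fun i => xchoose (ex i)); rewrite (meval_eq (v2 := v)) // => i.
exact: eqP (xchooseP (ex i)).
Qed.

Lemma dhomog_rational_point2 (k : finFieldType) (S : idomainType)
    (iota : {rmorphism k -> S}) n (P Q : {mpoly S[n]}) e e' :
  P != 0 -> P \is e.-homog -> Q != 0 -> Q \is e'.-homog -> (e + e' <= #|k|)%N ->
  exists2 c : 'I_n -> k, P.@[fun i => iota (c i)] != 0 & Q.@[fun i => iota (c i)] != 0.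
Proof.
move=> P0 hP Q0 hQ ek.
have [c] := dhomog_rational_point iota (mulf_neq0 P0 Q0) (dhomogM hP hQ) ek.
by rewrite mevalM mulf_eq0 negb_or => /andP[Pc Qc]; exists c.
Qed.

Section Directions.
Variables (k : finFieldType) (n : nat) (F : {mpoly k[n]}) (d : nat) (v : 'I_n -> k).
Hypotheses (hF : F \is d.-homog) (Fv : F.@[v] = 1) (sqF : sqfree (shift v F)).

Let p j := shift v F^`M(j).

Lemma shift_dirder u : shift v (dirder u F) = \sum_j ((u j)%:MP)%:P * p j.
Proof.
rewrite rmorph_sum; apply: eq_bigr => j _ /=.
by rewrite -mul_mpolyC rmorphM /= shiftC.
Qed.

(** If [g] divides d/dt of [shift v F], perfectness of [k] applies; otherwise the claim follows
    because d/dt is a combination of the [p j]. *)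
Lemma factor_direction g : irreducible_poly g -> g %| shift v F -> exists j, ~~ (g %| p j).
Proof.
move=> irr gF; case: (boolP (g %| (shift v F)^`())) => [gF'|].
  by have [j] := sqfree_perfect sqF irr gF gF'; rewrite map_mderiv_shift; exists j.
rewrite deriv_shift => nd; apply/existsP; apply: contraNT nd => /existsPn gp.
apply: (big_ind (fun x => g %| x)); [exact: dvdp0 | exact: dvdp_add |] => j _.
by apply: dvdp_mull; have := gp j; rewrite negbK.
Qed.

Lemma direction_polynomial (s : seq {poly {mpoly k[n]}}) :
  shift v F %= \prod_(g <- s) g -> (forall g, g \in s -> irreducible_poly g) ->
  exists P : {mpoly {mpoly k[n]}[n]}, [/\ P != 0, P \is (size s).-homog
    & forall u : 'I_n -> k, P.@[fun i => (u i)%:MP] != 0 ->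
        coprimep (shift v F) (shift v (dirder u F))].
Proof.
move=> eqF irr; have [|P [P0 hP uP]] := @direction_form {mpoly k[n]} n p s.
  move=> g gs; split; first exact: irreducible_neq0 (irr _ gs).
  apply: factor_direction; first exact: irr.
  by rewrite (eqp_dvdr _ eqF) (perm_big _ (perm_to_rem gs)) /= big_cons dvdp_mulIl.
exists P; split=> // u Pu; apply: coprimep_factors eqF irr _ => g gs.
by rewrite shift_dirder; apply: uP.
Qed.

Lemma exists_direction : (d <= #|k|)%N ->
  exists u : 'I_n -> k, coprimep (shift v F) (shift v (dirder u F)).
Proof.
have [monF sF] := shift_monic hF Fv.
move=> dk; have [s irr eqF] := irreducible_factorization (monic_neq0 monF).
have [P [P0 hP uP]] := direction_polynomial eqF irr.
have sd : (size s <= d)%N by have := size_factors eqF irr; rewrite sF.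
have [c Pc] := dhomog_rational_point (@mpolyC n k) P0 hP (leq_trans sd dk).
by exists c; apply: uP.
Qed.

(* An inseparable factor has degree at least 2, so then there are at most [d - 1] factors. *)
Lemma exists_own_direction : (d <= 1)%N \/ (d + d.-1 <= #|k|)%N ->
  exists2 u : 'I_n -> k, F.@[u] != 0 & coprime_mod F (dirder u F).
Proof.
have [monF sF] := shift_monic hF Fv; have F0 := monic_neq0 monF.
move=> dk; case: (boolP (coprimep (shift v F) (shift v F)^`())) => [cop|ncop].
  exists v; first by rewrite Fv oner_neq0.
  by apply: (coprimep_shift_mod hF Fv); rewrite -deriv_shift_dirder.
have [g irr gdvd] : exists2 g, irreducible_poly g & g %| gcdp (shift v F) (shift v F)^`().
  apply: exists_irreducible_factor; move: ncop; rewrite /coprimep.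
  have : gcdp (shift v F) (shift v F)^`() != 0 by rewrite gcdp_eq0 negb_and F0.
  by rewrite -size_poly_gt0; case: (size _) => [|[]].
move: gdvd; rewrite dvdp_gcd => /andP[gF gF'].
have g'0 : g^`() = 0.
  have := sqfree_dvdp_deriv (fun a b => derivM a b) sqF irr gF gF'.
  apply: contraTeq => g'0; rewrite gtNdvdp // lt_size_deriv //.
  exact: irreducible_neq0.
have g2 : (2 < size g)%N.
  case: irr => g1 _; rewrite ltn_neqAle g1 andbT; apply: contraTneq isT => sg.
  have := congr1 (coefp 0) g'0; rewrite /= coef_deriv coef0 mulr1n => /eqP.
  have -> : g`_1 = lead_coef g by rewrite lead_coefE -sg.
  by rewrite lead_coef_eq0 -size_poly_eq0 -sg.
have d2 : (1 < d)%N.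
  by rewrite -ltnS -sF; apply: leq_trans g2 _; apply: dvdp_leq.
case: dk => [|dk]; first by rewrite leqNgt d2.
have [s irrs eqF] := irreducible_factorization F0.
have [P [P0 hP uP]] := direction_polynomial eqF irrs.
have [h hs gh] : exists2 h, h \in s & g %| h.
  move: gF; rewrite (eqp_dvdr _ eqF); elim: (s) => [|h s' IHs].
    by rewrite big_nil dvdp1 => /eqP g1; case: irr; rewrite g1.
  rewrite big_cons irreducible_dvdpM // => /orP[gh|/IHs[h' h's gh']].
    by exists h; rewrite ?mem_head.
  by exists h'; rewrite ?inE ?h's ?orbT.
have h2 : (2 < size h)%N.
  by apply: leq_trans g2 _; apply: dvdp_leq gh; apply: irreducible_neq0 (irrs _ hs).
have sd : (size s <= d.-1)%N.
  by have := size_factors_lt eqF irrs hs h2; rewrite sF /=; case: (d) d2.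
(* [F] regarded as a form in the direction. Requiring that it be nonzero together with [P] makes the
   direction a possible new base point, at the cost of total degree at most [d + d.-1]. *)
pose F' := map_mpoly (@mpolyC n k) F.
have F'0 : F' != 0.
  apply: contraNneq (oner_neq0 k) => F'0; rewrite -Fv (_ : F = 0) ?meval0 //.
  apply/mpolyP=> m; have /(congr1 (mcoeff m)) := F'0.
  by rewrite mcoeff_map_mpoly !mcoeff0 => /eqP; rewrite mpolyC_eq0 => /eqP.
have hF' : F' \is d.-homog.
  apply/dhomogP=> m; rewrite mcoeff_msupp mcoeff_map_mpoly mpolyC_eq0 -mcoeff_msupp.
  exact: (dhomog_mf hF).
have sdk : (size s + d <= #|k|)%N by apply: leq_trans dk; rewrite addnC leq_add2l.
have [u Pu F'u] := dhomog_rational_point2 (@mpolyC n k) P0 hP F'0 hF' sdk.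
exists u; last by apply: (coprimep_shift_mod hF Fv); apply: uP.
apply: contraNneq F'u => Fu; apply/eqP.
have -> : F'.@[fun i => (u i)%:MP] = (F.@[u])%:MP; last by rewrite Fu mpolyC0.
apply: (mpoly_morph_eq (f := meval (fun i => (u i)%:MP) \o map_mpoly (@mpolyC n k))
  (g := @mpolyC n k \o meval u)) => [c|i] /=.
  by rewrite map_mpolyC ?mevalC ?mpolyC0.
by rewrite map_mpolyX ?mevalXU.
Qed.

End Directions.

(** * The degree of the resultant *)

Section Weights.
Variables (n : nat) (R : comNzRingType).
Local Notation S := {mpoly R[n]}.

Lemma msupp_const (c : R) m : m \in msupp (c%:MP : S) -> m = 0%MM.
Proof. by rewrite msuppC; case: (c == 0) => //; rewrite inE => /eqP. Qed.

(* Joint degree in [x] and [t] of a polynomial in [S[t]]. *)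
Definition wdeg_le e (p : {poly S}) :=
  forall i m, m \in msupp p`_i -> (mdeg m + i <= e)%N.

Lemma wdeg_leM e e' p q : wdeg_le e p -> wdeg_le e' q -> wdeg_le (e + e') (p * q).
Proof.
move=> hp hq i m; rewrite coefM => /msupp_sum_le/flattenP[s /mapP[j _ ->]].
move=> /msuppM_le/allpairsP[[m1 m2] /= [m1p m2q ->]].
have ji : (j <= i)%N by rewrite -ltnS.
rewrite mdegD -(subnKC ji) addnACA leq_add ?hp //.
by apply: hq.
Qed.

Lemma wdeg_leD e p q : wdeg_le e p -> wdeg_le e q -> wdeg_le e (p + q).
Proof.
by move=> hp hq i m; rewrite coefD => /msuppD_le; rewrite mem_cat => /orP[/hp|/hq].
Qed.

Lemma wdeg_leC e c : mdeg_le e c -> wdeg_le e c%:P.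
Proof.
move=> hc i m; rewrite coefC; case: eqP => [->|_]; last by rewrite msupp0.
by rewrite addn0; apply: hc.
Qed.

Lemma wdeg_leW e e' p : (e <= e')%N -> wdeg_le e p -> wdeg_le e' p.
Proof. by move=> ee hp i m /hp; move/leq_trans; apply. Qed.

Lemma wdeg_le_shift v (G : S) e : mdeg_le e G -> wdeg_le e (shift v G).
Proof.
move=> hG; have wc (c : R) : wdeg_le 0 (c%:MP%:P : {poly S}).
  by apply: wdeg_leC => m /msupp_const->; rewrite mdeg0.
have wX i : wdeg_le 1 (shift v 'X_i).
  rewrite shiftX; apply: wdeg_leD.
    rewrite -[1%N]add0n; apply: wdeg_leM => // j m; rewrite coefX.
    case: eqP => [->|_]; last by rewrite msupp0.
    by rewrite msupp1 inE => /eqP->; rewrite mdeg0.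
  by apply: wdeg_leC => m /mem_msuppXP <-; rewrite mdeg1.
rewrite (mpolyE G) rmorph_sum big_seq.
apply: (big_ind (wdeg_le e)) => [|p q|m mG].
- by move=> i m; rewrite coef0 msupp0.
- exact: wdeg_leD.
apply: (wdeg_leW (hG m mG)); rewrite -mul_mpolyC rmorphM /= shiftC -[mdeg m]add0n.
apply: wdeg_leM => //; rewrite mpolyXE_id rmorph_prod mdegE.
elim/big_ind2: _ => [|a p b q|i _].
- by rewrite -polyC1 -mpolyC1; apply: wc.
- exact: wdeg_leM.
rewrite rmorphXn; elim: (m i) => [|j IHj]; first by rewrite expr0 -polyC1 -mpolyC1; apply: wc.
by rewrite exprS -add1n; apply: wdeg_leM (wX i) IHj.
Qed.

Variable d : nat.
Implicit Type M : 'M[S]_d.+1.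

(** Entry [(i, j)] has degree at most [a + i - j]: this is the shape of multiplication by an element
    of joint degree [a] in the basis of powers of [t]. *)
Definition wmx_le a M := forall i j m, m \in msupp (M i j) -> (mdeg m + j <= a + i)%N.

Lemma wmx_leM a b M M' : wmx_le a M -> wmx_le b M' -> wmx_le (a + b) (M *m M').
Proof.
move=> hM hM' i j m; rewrite mxE => /msupp_sum_le/flattenP[s /mapP[l _ ->]].
move=> /msuppM_le/allpairsP[[m1 m2] /= [m1M m2M ->]].
have := leq_add (hM _ _ _ m1M) (hM' _ _ _ m2M); rewrite mdegD; lia.
Qed.

Lemma wmx_leD a M M' : wmx_le a M -> wmx_le a M' -> wmx_le a (M + M').
Proof.
move=> hM hM' i j m; rewrite mxE => /msuppD_le.
by rewrite mem_cat => /orP[/hM|/hM'].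
Qed.

Lemma wmx_leX M i : wmx_le 1 M -> wmx_le i (M ^+ i).
Proof.
move=> hM; elim: i => [|i IHi]; last by rewrite exprS -add1n; apply: wmx_leM.
move=> a b m; rewrite expr0 mxE; case: eqP => [->|_]; last by rewrite msupp0.
by rewrite msupp1 inE => /eqP->; rewrite mdeg0.
Qed.

Lemma wmx_leZ a b c M : mdeg_le b c -> wmx_le a M -> wmx_le (b + a) (c *: M).
Proof.
move=> hc hM i j m; rewrite mxE => /msuppM_le/allpairsP[[m1 m2] /= [m1c m2M ->]].
by have := leq_add (hc _ m1c) (hM _ _ _ m2M); rewrite mdegD; lia.
Qed.

(** In the product along a permutation the weights of the rows cancel those of the columns. *)
Lemma mdeg_le_det a M : wmx_le a M -> mdeg_le (d.+1 * a) (\det M).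
Proof.
move=> hM m; rewrite /determinant => /msupp_sum_le/flattenP[t /mapP[s _ ->]].
rewrite -signr_odd; have -> : ((-1) ^+ odd s : S) = ((-1) ^+ odd s)%:MP.
  by rewrite rmorphXn /= mpolyCN mpolyC1.
rewrite mul_mpolyC => /msuppZ_le.
have : forall (r : seq 'I_d.+1) m', m' \in msupp (\prod_(i <- r) M i (s i)) ->
    (mdeg m' + \sum_(i <- r) s i <= size r * a + \sum_(i <- r) i)%N.
  elim=> [|i r IHr] m'; first by rewrite !big_nil msupp1 inE => /eqP->; rewrite mdeg0.
  rewrite !big_cons => /msuppM_le/allpairsP[[m1 m2] /= [m1M m2M ->]].
  by have := leq_add (hM _ _ _ m1M) (IHr _ m2M); rewrite mdegD mulSn; lia.
move=> /(_ (index_enum _) m) H /H.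
have -> : size (index_enum (Finite.clone _ 'I_d.+1)) = d.+1.
  by rewrite -[RHS]card_ord cardT /= enumT.
rewrite [X in (_ <= _ + X)%N](reindex_inj (@perm_inj _ s)) /=.
by rewrite leq_add2r.
Qed.

Lemma wmx_le_cmx (f : {poly S}) : wdeg_le d.+1 f -> wmx_le 1 (cmx d f).
Proof.
move=> hf i j m; rewrite mxE; case: eqP => [->|_].
  by rewrite (perm_mem (msuppN _)) add1n; apply: hf.
case: eqP => [<-|_]; last by rewrite msupp0.
by rewrite msupp1 inE => /eqP->; rewrite mdeg0.
Qed.

Lemma mdeg_le_pnorm (f c : {poly S}) e : wdeg_le d.+1 f -> wdeg_le e c ->
  mdeg_le (d.+1 * e) (pnorm d f c).
Proof.
move=> hf hc; apply: mdeg_le_det.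
rewrite -[c]coefK poly_def rmorph_sum /=.
apply: (big_ind (wmx_le e)) => [i j m|M M'|i _].
- by rewrite mxE msupp0.
- exact: wmx_leD.
rewrite linearZ /= rmorphXn /= horner_mx_X => a b m mM.
have [ce|ce] := leqP i e; last first.
  suff c0 : c`_i = 0 by move: mM; rewrite c0 scale0r mxE msupp0.
  apply/mpolyP=> m'; rewrite mcoeff0; apply/memN_msupp_eq0/negP => /hc.
  by rewrite leqNgt (leq_trans ce) // leq_addl.
have hci : mdeg_le (e - i) c`_i by move=> m' /hc; rewrite leq_subRL // addnC.
have := wmx_leZ hci (wmx_leX (i := i) (wmx_le_cmx hf)).
by rewrite subnK //; apply.
Qed.

End Weights.

Lemma mdeg_le_homog n (R : nzRingType) (p : {mpoly R[n]}) e : p \is e.-homog -> mdeg_le e p.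
Proof. by move=> hp m mp; rewrite (homog_mdeg hp mp). Qed.

Lemma mdeg_le_dirder n (R : comNzRingType) (u : 'I_n -> R) (F : {mpoly R[n]}) d :
  F \is d.-homog -> mdeg_le d.-1 (dirder u F).
Proof.
move=> hF m /msupp_sum_le/flattenP[s /mapP[i _ ->]] /msuppZ_le.
rewrite mcoeff_msupp mcoeff_deriv => nz.
have : (m + U_(i))%MM \in msupp F.
  by rewrite mcoeff_msupp; apply: contraNneq nz => ->; rewrite mul0rn.
by move/(homog_mdeg hF) <-; rewrite mdegD mdeg1 addn1.
Qed.

(** * Points where the resultant does not vanish *)

Section SmallPoint.
Variables (k : finFieldType) (n : nat).

(** Evaluation at [a + s b] with [s] transcendental. Values stay in [k[s]]; a rational hyperplane
    contains this point once it contains [a] and [b]. *)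
Definition poly_point (a b : 'I_n -> k) : {mpoly k[n]} -> {poly k} :=
  mmap (@polyC k) (fun i => (a i)%:P + b i *: 'X).
HB.instance Definition _ a b := GRing.RMorphism.on (poly_point a b).

Lemma poly_pointC a b c : poly_point a b c%:MP = c%:P. Proof. exact: mmapC. Qed.

Lemma poly_pointX a b i : poly_point a b 'X_i = (a i)%:P + b i *: 'X.
Proof. by rewrite /poly_point mmapX mmap1U. Qed.

Lemma poly_point_meval a b R :
  (map_mpoly (@polyC k) R).@[fun i => (a i)%:P + b i *: 'X] = poly_point a b R.
Proof.
apply: (mpoly_morph_eq (f := meval (fun i => (a i)%:P + b i *: 'X) \o map_mpoly (@polyC k))
  (g := poly_point a b)) => [c|i] /=.
  by rewrite map_mpolyC ?mevalC ?poly_pointC ?polyC0.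
by rewrite map_mpolyX mevalXU poly_pointX.
Qed.

(* The grid is [k + k t] in [k[t]], of size [#|k| ^ 2], or [k]. *)
Lemma exists_poly_point (R : {mpoly k[n]}) D : R != 0 -> mdeg_le D R ->
  (D < #|k| ^ 2)%N -> exists a b, poly_point a b R != 0.
Proof.
move=> R0 hR Dk.
pose s := [seq c.1%:P + c.2 *: 'X | c <- enum {: k * k}].
have us : uniq s.
  rewrite map_inj_uniq ?enum_uniq // => -[a b] [a' b'] /= e.
  have := congr1 (coefp 0) e; have := congr1 (coefp 1) e.
  by rewrite /= !coefD !coefC !coefZ !coefX /= !mulr1 !mulr0 !addr0 !add0r => -> ->.
pose R' := map_mpoly (@polyC k) R.
have R'0 : R' != 0.
  apply: contraNneq R0 => R'0; apply/eqP/mpolyP=> m; have /(congr1 (mcoeff m)) := R'0.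
  by rewrite mcoeff_map_mpoly !mcoeff0 => /eqP; rewrite polyC_eq0 => /eqP.
have [m mR i|y ys Ry] := mpoly_grid_neq0 us R'0.
  rewrite size_map -cardE card_prod mulnn; apply: leq_ltn_trans Dk.
  apply: (@leq_trans (mdeg m)); first by rewrite mdegE (bigD1 i) //= leq_addr.
  by apply: hR; move: mR; rewrite !mcoeff_msupp mcoeff_map_mpoly polyC_eq0.
have ex i : exists c : k * k, c.1%:P + c.2 *: 'X == y i.
  by have /mapP[c _ ->] := ys i; exists c.
exists (fun i => (xchoose (ex i)).1), (fun i => (xchoose (ex i)).2).
rewrite -poly_point_meval (meval_eq (v2 := y)) // => i.
exact: eqP (xchooseP (ex i)).
Qed.

Lemma exists_const_point (R : {mpoly k[n]}) D : R != 0 -> mdeg_le D R ->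
  (D < #|k|)%N -> exists a, poly_point a (fun=> 0) R != 0.
Proof.
move=> R0 hR Dk; have [m mR i|a _ Ra] := mpoly_grid_neq0 (enum_uniq k) R0.
  rewrite -cardE; apply: leq_ltn_trans Dk; apply: leq_trans (hR m mR).
  by rewrite mdegE (bigD1 i) //= leq_addr.
exists a; suff -> : poly_point a (fun=> 0) R = (R.@[a])%:P by rewrite polyC_eq0.
apply: (mpoly_morph_eq (f := poly_point a (fun=> 0)) (g := @polyC k \o meval a)) => [c|i] /=.
  by rewrite poly_pointC mevalC.
by rewrite poly_pointX scale0r addr0 mevalXU.
Qed.

End SmallPoint.

(** * Reducedness of the hyperplane section *)

Section Projection.
Variables (R : comNzRingType) (n : nat) (w e : 'I_n -> R).

Lemma hproj_homog F d : F \is d.-homog -> hproj w e F \is d.-homog.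
Proof.
move=> hF; rewrite (mpolyE F) rmorph_sum big_seq; apply: rpred_sum => m mF.
rewrite -mul_mpolyC rmorphM /= hprojC mul_mpolyC; apply: rpredZ.
rewrite mpolyXE_id rmorph_prod -(homog_mdeg hF mF) mdegE.
elim/big_ind2: _ => [|a p b q|i _]; [exact: dhomog1 | exact: dhomogM |].
have h1 : 'X_i - e i *: linform w \is 1.-homog.
  apply: rpredB; first by rewrite dhomogX; apply/eqP; apply: mdeg1.
  by apply: rpredZ; apply: linform_homog.
by have := dhomogMn (m i) h1; rewrite mul1n rmorphXn /= hprojX.
Qed.

(** Both sides are derivations along [hproj]. On a variable they agree because the linear form is
    constant in a direction that lies in the hyperplane. *)
Lemma dirder_hproj u F : \sum_i w i * u i = 0 ->
  dirder u (hproj w e F) = hproj w e (dirder u F).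
Proof.
move=> wu; have dM a b : dirder u (a * b) = dirder u a * b + a * dirder u b.
  rewrite mulr_suml mulr_sumr -big_split /=; apply: eq_bigr => i _.
  by rewrite mderivM scalerDr scalerAl scalerAr.
have dD a b : dirder u (a + b) = dirder u a + dirder u b.
  by rewrite -big_split; apply: eq_bigr => i _; rewrite mderivD scalerDr.
have dC c : dirder u c%:MP = 0.
  by rewrite /dirder big1 // => i _; rewrite mderivC scaler0.
have dZ c a : dirder u (c *: a) = c *: dirder u a.
  by rewrite -mul_mpolyC dM dC mul0r add0r mul_mpolyC.
have dX i : dirder u 'X_i = (u i)%:MP.
  rewrite /dirder (bigD1 i) //= big1 => [|j ji].
    rewrite addr0 mderivX mnm1E eqxx scale1r.
    rewrite (_ : (U_(i) - U_(i))%MM = 0%MM) ?mpolyX0 -?mul_mpolyC ?mulr1 //.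
    by apply/mnmP=> a; rewrite mnmBE subnn mnm0E.
  by rewrite mderivX mnm1E eq_sym (negPf ji) scale0r scaler0.
apply: (mpoly_deriv_eq (f := hproj w e) (E := dirder u \o hproj w e)
  (E' := hproj w e \o dirder u)) => [a b|a b|a b|a b|c|i] /=.
- by rewrite rmorphD dD.
- by rewrite dD rmorphD.
- by rewrite rmorphM dM.
- by rewrite dM rmorphD !rmorphM.
- by rewrite hprojC !dC rmorph0.
rewrite hprojX dX hprojC -scaleNr dD dX dZ (_ : dirder u (linform w) = 0) ?scaler0 ?addr0 //.
rewrite /linform (big_morph (dirder u) dD (_ : dirder u 0 = 0)); last by rewrite -(mpolyC0 n R) dC.
rewrite -[RHS](mpolyC0 n R) -wu rmorph_sum; apply: eq_bigr => i' _ /=.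
by rewrite dZ dX -mul_mpolyC -mpolyCM.
Qed.

End Projection.

Section HyperplaneSection.
Variables (k : finFieldType) (n : nat) (F : {mpoly k[n.+1]}) (d : nat).
Variables (u v w a b : 'I_n.+1 -> k).
Hypotheses (hF : F \is d.-homog) (d0 : (0 < d)%N) (Fv : F.@[v] = 1).
Hypotheses (w0 : exists i, w i != 0) (wv : \sum_i w i * v i = 0)
  (wu : \sum_i w i * u i = 0) (wa : \sum_i w i * a i = 0) (wb : \sum_i w i * b i = 0).
Hypothesis cop : coprimep (map_poly (poly_point a b) (shift v F))
  (map_poly (poly_point a b) (shift v (dirder u F))).

(** The projection [G] of [F] plays the role of the restriction to the hyperplane while keeping the
    same variables. Since [a + s b] lies on the hyperplane, projecting does not change the
    polynomials in [cop], so [G] is radical. If [f ^+ N * p ^+ m] is in the ideal, then a power of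
    [f * p] projects to a multiple of [G], hence so does [f * p]. *)
Lemma reduced_hyperplane_section :
  reduced (scheme_inter (hypersurface F) (hypersurface (linform w))).
Proof.
have [i0 wi0] := w0; pose e i := (w i0)^-1 *+ (i == i0).
have we : \sum_i w i * e i = 1.
  rewrite (bigD1 i0) //= /e eqxx mulfV // big1 ?addr0 // => i /negPf->.
  by rewrite mulr0.
pose L := linform w; pose G := hproj w e F.
have hG : G \is d.-homog by apply: hproj_homog.
have Lv : L.@[v] = 0 by rewrite meval_linform.
have Gv : G.@[v] = 1 by rewrite -Fv; apply: (@morph_hproj k _ w e k (meval v)).
have LP : poly_point a b L = 0.
  have E i : poly_point a b (w i)%:MP * poly_point a b 'X_i =
      (w i * a i)%:P + (w i * b i) *: 'X.
    by rewrite poly_pointC poly_pointX mulrDr -polyCM mul_polyC scalerA.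
  rewrite morph_linform; under eq_bigr => i _ do rewrite /= E.
  by rewrite big_split /= -rmorph_sum /= -scaler_suml wa wb polyC0 scale0r addr0.
have mapL p : map_poly (poly_point a b) (shift v (hproj w e p)) =
    map_poly (poly_point a b) (shift v p).
  apply: (@morph_hproj k _ w e _ (map_poly (poly_point a b) \o shift v)).
  by rewrite /= shift_linform // map_polyC /= LP.
have dG : dirder u G = hproj w e (dirder u F) by apply: dirder_hproj.
have radG : forall g j, divisible G (g ^+ j) -> divisible G g.
  apply: (coprimep_radical (h := poly_point a b) (u := u) hG d0 Gv).
  rewrite dG /G; move: (mapL F) (mapL (dirder u F)) => e1 e2.
  refine (etrans _ cop); exact: (congr2 (fun x y => coprimep x y) e1 e2).
move=> _ _ m f p _ _ _ [N [x [y [[c ->] [c' ->] fp]]]].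
have [c1 Gfp] : divisible G (hproj w e (f * p)).
  apply: (radG _ (N + m)%N); exists (hproj w e c * hproj w e (f ^+ m * p ^+ N)).
  have hM x' y' : hproj w e (x' * y') = hproj w e x' * hproj w e y' by apply: rmorphM.
  have hX x' j : hproj w e (x' ^+ j) = hproj w e x' ^+ j by apply: rmorphXn.
  have hD x' y' : hproj w e (x' + y') = hproj w e x' + hproj w e y' by apply: rmorphD.
  have fpG : hproj w e (f ^+ N * p ^+ m) = hproj w e c * G.
    by rewrite fp hD !hM hproj_linform // mulr0 addr0.
  have fpX : (f * p) ^+ (N + m) = (f ^+ m * p ^+ N) * (f ^+ N * p ^+ m).
    by rewrite exprMn !exprD [f ^+ N * f ^+ m]mulrC mulrACA.
  rewrite -hX fpX hM fpG mulrA; congr (_ * G); exact: mulrC.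
have [c2 fpE] := hproj_mod w e (f * p); have [c3 FE] := hproj_mod w e F.
(* From [f * p = c1 * G + c2 * L] and [G = F - c3 * L]. *)
exists 1%N, (c1 * F), ((c2 - c1 * c3) * L); split; [by exists c1 | by eexists |].
have fpE' : f * p = c2 * L + c1 * G by rewrite -fpE -Gfp subrK.
have FE' : F = c3 * L + G by rewrite -FE subrK.
rewrite expr1 fpE' {1}FE' mulrDr mulrBl mulrA [RHS]addrC [RHS]addrA.
by congr (_ + _); rewrite subrK.
Qed.

Lemma hyperplane_section_exists m : n = m.+2 ->
  exists H : subscheme k n,
    [/\ is_hyperplane H, reduced (scheme_inter (hypersurface F) H)
      & has_dim (scheme_inter (hypersurface F) H) (n - 2)].
Proof.
move=> nm; exists (hypersurface (linform w)); split.
- exists (linform w); split=> //; [exact: linform_neq0 | exact: linform_homog].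
- exact: reduced_hyperplane_section.
move: F v w hF Fv w0 wv; rewrite nm subn2 /= => F' v' w' hF' Fv' w0' wv'.
exact: has_dim_hyperplane_section hF' d0 Fv' w0' wv'.
Qed.

End HyperplaneSection.

(** * Choice of the hyperplane and conclusion *)

Lemma exists_annihilator (k : fieldType) n (s : seq ('I_n -> k)) : (size s < n)%N ->
  exists2 w : 'I_n -> k, (exists i, w i != 0)
    & forall j, (j < size s)%N -> \sum_i w i * nth (fun=> 0) s j i = 0.
Proof.
move=> sn; pose M : 'M[k]_(n, size s) := \matrix_(i, j) nth (fun=> 0) s j i.
have : kermx M != 0.
  rewrite kermx_eq0 /row_free; apply: contraTneq sn => rM.
  by rewrite -leqNgt; have := rank_leq_col M; rewrite rM.
rewrite -nz_row_eq0 => w0; have /sub_kermxP wM := nz_row_sub (kermx M).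
exists (fun i => nz_row (kermx M) 0 i).
  apply/existsP; apply: contraNT w0 => /existsPn w0; apply/eqP/rowP=> i.
  by rewrite mxE; apply/eqP; have := w0 i; rewrite negbK.
move=> j js; have := congr1 (fun A : 'rV_ _ => A 0 (Ordinal js)) wM.
by rewrite !mxE => e0; rewrite -[RHS]e0; apply: eq_bigr => i _; rewrite mxE.
Qed.

Lemma hypersurfaceZ (k : fieldType) n (F : {mpoly k[n.+1]}) c : c != 0 ->
  hypersurface (c *: F) = hypersurface F.
Proof.
move=> c0; apply: functional_extensionality => p; apply: propositional_extensionality.
split=> -[q ->]; first by exists (c *: q); rewrite -scalerAr scalerAl.
by exists (c^-1 *: q); rewrite -scalerAr scalerAl scalerA mulfV // scale1r.
Qed.

Lemma coprime_modZ (k : fieldType) n (F : {mpoly k[n]}) u c : c != 0 ->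
  coprime_mod F (dirder u F) -> coprime_mod (c *: F) (dirder u (c *: F)).
Proof.
move=> c0 cop h [q hq].
have dZ : dirder u (c *: F) = c *: dirder u F.
  by rewrite scaler_sumr; apply: eq_bigr => i _; rewrite mderivZ !scalerA mulrC.
have [|q' ->] := cop h.
  exists q; have := congr1 (fun x => c^-1 *: x) hq.
  by rewrite dZ -!scalerAr !scalerA mulVf // !scale1r.
by exists (c^-1 *: q'); rewrite -scalerAr scalerAl scalerA mulfV // scale1r.
Qed.

Section PointToSection.
Variables (k : finFieldType) (n m d : nat) (F : {mpoly k[n.+1]}) (u v : 'I_n.+1 -> k).
Hypotheses (nm : n = m.+2) (hF : F \is (d.+1).-homog) (Fv : F.@[v] = 1).
Hypothesis cop : coprimep (shift v F) (shift v (dirder u F)).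

Let R := pnorm d (shift v F) (shift v (dirder u F)).

Let R_neq0 : R != 0.
Proof.
have [monF sF] := shift_monic hF Fv.
by rewrite (pnorm_coprimep _ monF sF).
Qed.

Let mdeg_R : mdeg_le (d.+1 * d) R.
Proof.
apply: mdeg_le_pnorm; apply: wdeg_le_shift; first exact: mdeg_le_homog.
exact: (mdeg_le_dirder (u := u) hF).
Qed.

(** [s] lists vectors such that every hyperplane through them contains [v], [u], [a] and [b]. There
    is room for two vectors if [n = 2], three if [n = 3] and four if [n >= 4]. Nonvanishing of the
    resultant at [a + s b] is coprimality after specialization. *)
Lemma section_of_point a b (s : seq ('I_n.+1 -> k)) :
  poly_point a b R != 0 -> (size s < n.+1)%N ->
  (forall w : 'I_n.+1 -> k,
     (forall j, (j < size s)%N -> \sum_i w i * nth (fun=> 0) s j i = 0) ->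
     [/\ \sum_i w i * v i = 0, \sum_i w i * u i = 0,
         \sum_i w i * a i = 0 & \sum_i w i * b i = 0]) ->
  exists H : subscheme k n,
    [/\ is_hyperplane H, reduced (scheme_inter (hypersurface F) H)
      & has_dim (scheme_inter (hypersurface F) H) (n - 2)].
Proof.
move=> Rab sn span; have [w w0 /span[wv wu wa wb]] := exists_annihilator sn.
apply: (hyperplane_section_exists (a := a) (b := b) hF _ Fv w0 wv wu wa wb _ nm) => //.
have [monF sF] := shift_monic hF Fv.
have sF' : size (map_poly (poly_point a b) (shift v F)) = d.+2.
  by rewrite size_map_poly_id0 ?sF // (eqP monF) rmorph1 oner_neq0.
by rewrite -(pnorm_coprimep _ _ sF') ?monic_map // -map_pnorm.
Qed.

Lemma section_of_const_point : (d.+1 * d < #|k|)%N -> (0 < m)%N \/ u = v ->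
  exists H : subscheme k n,
    [/\ is_hyperplane H, reduced (scheme_inter (hypersurface F) H)
      & has_dim (scheme_inter (hypersurface F) H) (n - 2)].
Proof.
move=> dk uv; have [a Ra] := exists_const_point R_neq0 mdeg_R dk.
have z (w : 'I_n.+1 -> k) : \sum_i w i * 0 = 0 by rewrite big1 // => i _; rewrite mulr0.
case: uv => [m0|uv].
  apply: (section_of_point (s := [:: v; u; a]) Ra); first by rewrite /=; lia.
  by move=> w h; split; [exact: (h 0%N)|exact: (h 1%N)|exact: (h 2%N)|exact: z].
apply: (section_of_point (s := [:: v; a]) Ra); first by rewrite /=; lia.
by move=> w h; rewrite uv; split; [exact: (h 0%N)|exact: (h 0%N)|exact: (h 1%N)|exact: z].
Qed.

Lemma section_of_quadratic_point : (d.+1 * d < #|k| ^ 2)%N -> (1 < m)%N ->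
  exists H : subscheme k n,
    [/\ is_hyperplane H, reduced (scheme_inter (hypersurface F) H)
      & has_dim (scheme_inter (hypersurface F) H) (n - 2)].
Proof.
move=> dk m1; have [a [b Rab]] := exists_poly_point R_neq0 mdeg_R dk.
apply: (section_of_point (s := [:: v; u; a; b]) Rab); first by rewrite /=; lia.
by move=> w h; split; [exact: (h 0%N)|exact: (h 1%N)|exact: (h 2%N)|exact: (h 3%N)].
Qed.

End PointToSection.

Theorem theorem1p5 (k : finFieldType) (q : nat) (hq : #|k| = q)
    (n d : nat) (hn : (2 <= n)%N) (hd : (0 < d)%N)
    (F : {mpoly k[n.+1]}) (hF0 : F != 0) (hFd : F \is d.-homog)
    (hX : reduced (hypersurface F))
    (h2 : n = 2%N -> (3%:Q / 2%:Q) * (d%:Q * (d%:Q - 1)) <= q%:Q)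
    (h3 : n = 3%N -> (d * (d - 1) + 1 <= q)%N)
    (h4 : (4 <= n)%N -> (d <= q)%N) :
  exists H : subscheme k n,
    [/\ is_hyperplane H,
        reduced (scheme_inter (hypersurface F) H)
      & has_dim (scheme_inter (hypersurface F) H) (n - 2)].
Proof.
have q2 : (1 < q)%N by rewrite -hq (cardD1 0) (cardD1 1) !inE oner_neq0.
have {}h2 : n = 2%N -> (3 * (d * (d - 1)) <= 2 * q)%N.
  move/h2; have -> : d%:Q - 1 = (d - 1)%N%:Q by rewrite -[1]/(1%N%:Q) -intrB subzn.
  rewrite mulrAC Num.Theory.ler_pdivrMr // -!intrM ler_int.
  by rewrite -!PoszM lez_nat [(q * 2)%N]mulnC.
(* From here on the degree is [d.+1], matching the size convention of [pnorm]. *)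
case: d hd hFd h2 h3 h4 => // d _ hFd h2 h3 h4.
rewrite subn1 /= in h2 h3.
have dq : (d.+1 <= q)%N.
  have [n2|n3] := eqVneq n 2%N; first by have := h2 n2; nia.
  have [n3'|n4] := eqVneq n 3%N; first by have := h3 n3'; nia.
  by apply: h4; lia.
have [m nm] : exists m, n = m.+2 by exists n.-2; lia.
have [v0 Fv0] : exists v, F.@[v] != 0.
  by apply: (dhomog_rational_point (S := k) idfun hF0 hFd); rewrite hq.
have scale v : F.@[v] != 0 -> [/\ (F.@[v])^-1 *: F \is (d.+1).-homog,
    ((F.@[v])^-1 *: F).@[v] = 1 & hypersurface ((F.@[v])^-1 *: F) = hypersurface F].
  move=> Fv; split; [exact: dhomogZ | by rewrite mevalZ mulVf | by rewrite hypersurfaceZ ?invr_neq0].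
have [hF1 F1v hyp1] := scale v0 Fv0; set F1 := _ *: F in hF1 F1v hyp1.
have sqF1 : sqfree (shift v0 F1).
  apply: (radical_sqfree hF1 F1v).
  have [|w w0] := @exists_annihilator k n.+1 [:: v0]; first by rewrite /=; lia.
  move=> /(_ 0%N isT) /= wv.
  apply: (reduced_radical hF1 F1v (linform_neq0 w0) (linform_homog w) (shift_linform wv)).
  by rewrite hyp1.
case: (posnP m) => [m0|m0].
  have n2 : n = 2%N by rewrite nm m0.
  have [|u F1u cop] := exists_own_direction hF1 F1v sqF1.
    (* For [d >= 1], the inequality [3 (d + 1) d <= 2 q] implies [2 d + 1 <= q]. *)
    have := h2 n2; rewrite hq; case: (d) => [|[|d']] h; [by left|right; lia|right; nia].
  (* The direction [u] becomes the base point, so [F1] is rescaled to take the value 1 there. *)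
  have [hF2 F2u hyp2] : [/\ (F1.@[u])^-1 *: F1 \is (d.+1).-homog,
     ((F1.@[u])^-1 *: F1).@[u] = 1 & hypersurface ((F1.@[u])^-1 *: F1) = hypersurface F1].
    split; [exact: dhomogZ | by rewrite mevalZ mulVf | by rewrite hypersurfaceZ ?invr_neq0].
  have cop2 := mod_coprimep_shift hF2 F2u (coprime_modZ (invr_neq0 F1u) cop).
  rewrite -hyp1 -hyp2; apply: (section_of_const_point nm hF2 F2u cop2); last by right.
  by have := h2 n2; rewrite hq; case: (d) => [|d'] h; nia.
have [|u cop] := exists_direction hF1 F1v sqF1; first by rewrite hq.
rewrite -hyp1; case: (ltnP 1 m) => m1.
  (* Here [d + 1 <= q] gives [(d + 1) d < q ^ 2]. *)
  by apply: (section_of_quadratic_point nm hF1 F1v cop) => //; rewrite hq; nia.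
apply: (section_of_const_point nm hF1 F1v cop); last by left.
by have := h3 _; rewrite hq => h; have := h ltac:(lia); nia.
Qed.
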